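(* Let $M$ be a smooth manifold, $\nabla$ a higher connection on $M$, $\omega\in\Omega^l(M)$, and $X\in A^k(M)$ with $k>0$. Then $\nabla_X\omega\in\Omega^{l-k+1}(M)$; that is, when $l-k+1\ge0$, the assignment $$Y\mapsto(\nabla_X\omega)(Y):=(-1)^{(k-1)(l-1)}L_Xi_Y\omega-\omega(\nabla_XY),\qquad Y\in A^{l-k+1}(M),$$ is a well-defined differential form of degree $l-k+1$ on $M$.
   Context: $A^k(M):=\Gamma(\wedge^kTM)$ for $k\ge0$ ($A^0(M)=C^\infty(M)$), $A^k(M):=0$ and $\Omega^k(M):=0$ for $k<0$, $\mathcal{A}(M):=\bigoplus_kA^k(M)$. Schouten–Nijenhuis bracket: the unique $\mathbb{R}$-bilinear map $[\cdot,\cdot]:A^k(M)\times A^l(M)\to A^{k+l-1}(M)$ such that $[f,g]=0$ for functions; $[X,Q]=L_XQ$ for $X\in A^1(M)$; $[P,Q]=-(-1)^{(p-1)(q-1)}[Q,P]$ and $[P,Q\wedge R]=[P,Q]\wedge R+(-1)^{(p-1)q}Q\wedge[P,R]$ for $P\in A^p(M)$, $Q\in A^q(M)$, $R\in\mathcal{A}(M)$. A higher (affine) connection on $M$ is a map $\nabla:\mathcal{A}(M)\times\mathcal{A}(M)\to\mathcal{A}(M)$, $(X,Y)\mapsto\nabla_XY$, such that (i) $\nabla_XY\in A^{k+l-1}(M)$ for $X\in A^k(M)$, $Y\in A^l(M)$; (ii) $\nabla_{fX+X'}Y=f\nabla_XY+\nabla_{X'}Y$ for $f\in C^\infty(M)$;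 (iii) $\nabla_X(Y+Y')=\nabla_XY+\nabla_XY'$; (iv) $\nabla_Xf=[X,f]$ for $f\in C^\infty(M)$; (v) $\nabla_X(fY)=[X,f]\wedge Y+f\nabla_XY$ for $f\in C^\infty(M)$; (vi) $\nabla_fX=0$ for $f\in C^\infty(M)$. Forms: $\omega\in\Omega^k(M)$ is evaluated on $k$-vectors by $(\omega^1\wedge\cdots\wedge\omega^k)(v_1\wedge\cdots\wedge v_k)=\det(\omega^i(v_j))$; for $\omega\in\Omega^0(M)$ and $f\in A^0(M)$, $\omega(f):=f\omega$. For $X\in A^k(M)$, $k\ge1$, $i_X:\Omega^l(M)\to\Omega^{l-k}(M)$ is $(i_X\omega)(Y)=\omega(X\wedge Y)$ for $l>k$, $i_X\omega=\omega(X)$ for $l=k$, $i_X\omega=0$ for $l<k$; $i_f\omega:=f\omega$ for functions. $L_X\omega:=d\,i_X\omega-(-1)^ki_Xd\omega$ for $X\in A^k(M)$, $k\ge1$. By definition $\nabla_X\omega:=0$ if $l-k+1<0$. *)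

(* Defs.v *)
From HB Require Import structures.
From mathcomp Require Import all_boot all_order all_algebra.
From mathcomp Require Import all_classical all_reals all_analysis.
Import Order.TTheory GRing.Theory Num.Theory.
Import numFieldNormedType.Exports.
Set Implicit Arguments.
Unset Strict Implicit.
Unset Printing Implicit Defensive.
Local Open Scope classical_set_scope.
Local Open Scope ring_scope.

(* The exterior algebra of R^n in the basis e_I = e_{i_1} /\ ... /\ e_{i_k}
   indexed by the subsets I = {i_1 < ... < i_k} of 'I_n.  It is used both for
   multivectors and, in the dual basis, for exterior forms. *)

Definition ext (R : realType) (n : nat) := {ffun {set 'I_n} -> R^o}.

Definition ebase {R : realType} {n : nat} (I : {set 'I_n}) : ext R n :=
  [ffun J : {set 'I_n} => (J == I)%:R].

(* Degrees are integers, so that there is nothing but 0 in degree k < 0. *)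
Definition homog {R : realType} {n : nat} (k : int) (x : ext R n) : Prop :=
  forall I : {set 'I_n}, x I != 0 -> (#|I|)%:Z = k.

Definition inversions {n : nat} (I J : {set 'I_n}) : nat :=
  #|[set ij : 'I_n * 'I_n |
      [&& ij.1 \in I, ij.2 \in J & (ij.2 < ij.1)%N]]|.

Definition wedge {R : realType} {n : nat} (x y : ext R n) : ext R n :=
  [ffun K : {set 'I_n} => \sum_(I : {set 'I_n} | I \subset K)
     (-1) ^+ inversions I (K :\: I) * (x I * y (K :\: I))].

(* The basis e_I of multivectors and the basis dx^I of forms are dual, because
   (dx^I)(e_J) = det (dx^{i_a}(e_{j_b})) is 1 if I = J and 0 otherwise. *)
Definition pairing {R : realType} {n : nat} (w x : ext R n) : R :=
  \sum_(I : {set 'I_n}) w I * x I.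

(* (i_x w)(y) = w (x /\ y); the degree conditions are automatic. *)
Definition contract {R : realType} {n : nat} (x w : ext R n) : ext R n :=
  [ffun J : {set 'I_n} => pairing w (wedge x (ebase J))].

(* The algebra morphism induced by v |-> v *m A; enum I is increasing. *)
Definition extmap {R : realType} {n : nat} (A : 'M[R]_n) (x : ext R n) :
    ext R n :=
  \sum_(I : {set 'I_n}) x I *:
    \big[wedge/ebase finset.set0]_(i <- enum I)
      \sum_(j < n) (A i j : R) *: ebase (R := R) [set j]%SET.

Definition pdiff {R : realType} {n : nat} (i : 'I_n)
    (F : 'rV[R]_n -> ext R n) (u : 'rV[R]_n) : ext R n :=
  [ffun I : {set 'I_n} => 'D_(delta_mx ord0 i) (fun v => F v I : R) u].

Fixpoint ndifferentiable {R : realType} {n : nat} (r : nat)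
    (D : set 'rV[R]_n) (f : 'rV[R]_n -> R) : Prop :=
  match r with
  | 0%N => {in D, continuous f}
  | r'.+1 => (forall u, D u -> differentiable f u) /\
      forall i : 'I_n, ndifferentiable r' D ('D_(delta_mx ord0 i) f)
  end.

Definition smooth_on {R : realType} {n : nat} (D : set 'rV[R]_n)
    (f : 'rV[R]_n -> R) : Prop := forall r : nat, ndifferentiable r D f.

(* Charts are total functions, relevant only on cdom and cimg respectively. *)
Record chart (R : realType) (n : nat) (T : Type) := Chart {
  cdom : set T;
  ccoord : T -> 'rV[R]_n;
  cparam : 'rV[R]_n -> T }.

Definition cimg {R : realType} {n : nat} {T : Type} (c : chart R n T) :
  set 'rV[R]_n := ccoord c @` cdom c.

Record is_chart {R : realType} {n : nat} {T : topologicalType}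
    (c : chart R n T) : Prop := IsChart {
  cdom_open : open (cdom c);
  cimg_open : open (cimg c);
  ccoordK : {in cdom c, cancel (ccoord c) (cparam c)};
  ccoord_continuous : {in cdom c, continuous (ccoord c)};
  cparam_continuous : {in cimg c, continuous (cparam c)} }.

Definition transition {R : realType} {n : nat} {T : Type} (c c' : chart R n T) :
  'rV[R]_n -> 'rV[R]_n := ccoord c' \o cparam c.

Definition smooth_compatible {R : realType} {n : nat} {T : Type}
    (c c' : chart R n T) : Prop :=
  forall j : 'I_n, smooth_on (ccoord c @` (cdom c `&` cdom c'))
    (fun u => transition c c' u ord0 j).

Record manifold (R : realType) (n : nat) := Manifold {
  carrier :> topologicalType;
  manifold_hausdorff : hausdorff_space carrier;
  manifold_second_countable : @second_countable carrier;
  atlas : set (chart R n carrier);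
  chart_at : carrier -> chart R n carrier;
  chart_at_atlas : forall p, atlas (chart_at p);
  chart_at_dom : forall p, cdom (chart_at p) p;
  atlas_chart : forall c, atlas c -> is_chart c;
  atlas_compatible : forall c c', atlas c -> atlas c' -> smooth_compatible c c'
}.

Definition smooth_fun {R : realType} {n : nat} {M : manifold R n}
    (f : M -> R) : Prop :=
  forall c, atlas c -> smooth_on (cimg c) (f \o cparam c).

(* T_pM is R^n, through the coordinates of the chart chart_at p, hence a section
   of the exterior algebra bundle of TM, or of T*M, is a function M -> ext R n:
   its value at p is expressed in the bases defined by chart_at p.  The
   components in another chart are obtained by means of the Jacobian matrices of
   the transition maps ('J acts on row vectors from the right). *)

Definition ext_field {R : realType} {n : nat} (M : manifold R n) := M -> ext R n.

Definition mv_coord {R : realType} {n : nat} {M : manifold R n}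
    (c : chart R n M) (X : ext_field M) (u : 'rV[R]_n) : ext R n :=
  let p := cparam c u in let cp := chart_at p in
  extmap ('J (transition cp c) (ccoord cp p)) (X p).

Definition form_coord {R : realType} {n : nat} {M : manifold R n}
    (c : chart R n M) (w : ext_field M) (u : 'rV[R]_n) : ext R n :=
  let p := cparam c u in let cp := chart_at p in
  [ffun I : {set 'I_n} => pairing (w p) (extmap ('J (transition c cp) u) (ebase I))].

(* The elements of \mathcal{A}(M) *)
Definition multivector_field {R : realType} {n : nat} {M : manifold R n}
    (X : ext_field M) : Prop :=
  forall c, atlas c -> forall I : {set 'I_n},
    smooth_on (cimg c) (fun u => mv_coord c X u I).

(* A^k(M) *)
Definition kvector_field {R : realType} {n : nat} {M : manifold R n}
    (k : int) (X : ext_field M) : Prop :=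
  multivector_field X /\ forall p, homog k (X p).

(* \Omega^k(M) *)
Definition diff_form {R : realType} {n : nat} {M : manifold R n}
    (k : int) (w : ext_field M) : Prop :=
  (forall c, atlas c -> forall I : {set 'I_n},
     smooth_on (cimg c) (fun u => form_coord c w u I)) /\
  forall p, homog k (w p).

(* Functions, as multivector fields or forms of degree 0 *)
Definition of_fun {R : realType} {n : nat} {M : manifold R n} (f : M -> R) :
  ext_field M := fun p => f p *: ebase finset.set0.

Definition fscale {R : realType} {n : nat} {M : manifold R n} (f : M -> R)
  (X : ext_field M) : ext_field M := fun p => f p *: X p.

Definition fwedge {R : realType} {n : nat} {M : manifold R n} (X Y : ext_field M) :
  ext_field M := fun p => wedge (X p) (Y p).

(* The function w(X) *)
Definition feval {R : realType} {n : nat} {M : manifold R n} (w X : ext_field M) :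
  M -> R := fun p => pairing (w p) (X p).

(* i_X w *)
Definition fcontract {R : realType} {n : nat} {M : manifold R n}
  (X w : ext_field M) : ext_field M := fun p => contract (X p) (w p).

Definition ext_d {R : realType} {n : nat} {M : manifold R n} (w : ext_field M) :
    ext_field M := fun p =>
  let c := chart_at p in
  \sum_(i < n) wedge (ebase [set i]%SET)
    (pdiff i (form_coord c w) (ccoord c p)).

(* L_X Q for a vector field X: in coordinates, L_X is the derivation of the
   exterior algebra extending the usual bracket of vector fields, hence
   L_X Q = \sum_i (X^i \partial_i Q - \partial_i X /\ i_{dx^i} Q). *)
Definition lie_mv {R : realType} {n : nat} {M : manifold R n} (X Q : ext_field M) :
    ext_field M := fun p =>
  let c := chart_at p in
  \sum_(i < n)
    ((X p [set i]%SET : R) *: pdiff i (mv_coord c Q) (ccoord c p) -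
     wedge (pdiff i (mv_coord c X) (ccoord c p))
       (contract (ebase [set i]%SET) (Q p))).

(* L_X w for X of degree k *)
Definition lie_form {R : realType} {n : nat} {M : manifold R n} (k : int)
    (X w : ext_field M) : ext_field M := fun p =>
  ext_d (fcontract X w) p - ((-1) ^ k : R) *: fcontract X (ext_d w) p.

(* The axioms of the Schouten-Nijenhuis bracket and of higher connections bear
   on smooth sections only; values on other functions are irrelevant. *)

Record is_schouten {R : realType} {n : nat} {M : manifold R n}
    (br : ext_field M -> ext_field M -> ext_field M) : Prop := IsSchouten {
  schouten_linearl : forall (a : R) P P' Q, multivector_field P ->
    multivector_field P' -> multivector_field Q ->
    br (fun p => a *: P p + P' p) Q = (fun p => a *: br P Q p + br P' Q p);
  schouten_linearr : forall (a : R) P Q Q', multivector_field P ->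
    multivector_field Q -> multivector_field Q' ->
    br P (fun p => a *: Q p + Q' p) = (fun p => a *: br P Q p + br P Q' p);
  schouten_degree : forall (k l : int) P Q, kvector_field k P ->
    kvector_field l Q -> kvector_field (k + l - 1) (br P Q);
  schouten_fun : forall f g : M -> R, smooth_fun f -> smooth_fun g ->
    br (of_fun f) (of_fun g) = (fun=> 0);
  schouten_lie : forall X Q, kvector_field 1 X -> multivector_field Q ->
    br X Q = lie_mv X Q;
  schouten_antisym : forall (k l : int) P Q, kvector_field k P ->
    kvector_field l Q ->
    br P Q = (fun p => - ((-1) ^ ((k - 1) * (l - 1)) : R) *: br Q P p);
  schouten_leibniz : forall (k l : int) P Q S, kvector_field k P ->
    kvector_field l Q -> multivector_field S ->
    br P (fwedge Q S) = (fun p => fwedge (br P Q) S p +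
      ((-1) ^ ((k - 1) * l) : R) *: fwedge Q (br P S) p) }.

Record higher_connection {R : realType} {n : nat} {M : manifold R n}
    (br nabla : ext_field M -> ext_field M -> ext_field M) : Prop := HigherConnection {
  nabla_mv : forall X Y, multivector_field X -> multivector_field Y ->
    multivector_field (nabla X Y);
  nabla_degree : forall (k l : int) X Y, kvector_field k X ->
    kvector_field l Y -> kvector_field (k + l - 1) (nabla X Y);
  nabla_linearl : forall (f : M -> R) X X' Y, smooth_fun f ->
    multivector_field X -> multivector_field X' -> multivector_field Y ->
    nabla (fun p => f p *: X p + X' p) Y =
      (fun p => f p *: nabla X Y p + nabla X' Y p);
  nabla_addr : forall X Y Y', multivector_field X -> multivector_field Y ->
    multivector_field Y' ->
    nabla X (fun p => Y p + Y' p) = (fun p => nabla X Y p + nabla X Y' p);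
  nabla_fun : forall X (f : M -> R), multivector_field X -> smooth_fun f ->
    nabla X (of_fun f) = br X (of_fun f);
  nabla_leibniz : forall X (f : M -> R) Y, multivector_field X ->
    smooth_fun f -> multivector_field Y ->
    nabla X (fscale f Y) =
      (fun p => fwedge (br X (of_fun f)) Y p + f p *: nabla X Y p);
  nabla_of_fun : forall (f : M -> R) X, smooth_fun f -> multivector_field X ->
    nabla (of_fun f) X = (fun=> 0) }.

(* The right-hand side of the formula defining (\nabla_X w)(Y), for X of
   degree k and w of degree l, as a form of degree 0 *)
Definition nabla_form_value {R : realType} {n : nat} {M : manifold R n}
    (nabla : ext_field M -> ext_field M -> ext_field M) (k l : int) (X w Y : ext_field M) :
    ext_field M := fun p =>
  ((-1) ^ ((k - 1) * (l - 1)) : R) *: lie_form k X (fcontract Y w) p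
  - of_fun (feval w (nabla X Y)) p.

(* eta is \nabla_X w *)
Definition is_nabla_form {R : realType} {n : nat} {M : manifold R n}
    (nabla : ext_field M -> ext_field M -> ext_field M) (k l : int)
    (X w eta : ext_field M) :
    Prop :=
  if l - k + 1 < 0 then eta = (fun=> 0)
  else forall Y, kvector_field (l - k + 1) Y ->
    of_fun (feval eta Y) = nabla_form_value nabla k l X w Y.

(* Main.v *)
(** Write [nabla_X w (Y)] as a scalar.  Since [i_Y w] has degree [k - 1], [i_X i_Y w]
    vanishes and [L_X i_Y w = - (-1)^k <d (i_Y w), X>].  The map from [Y] to this
    scalar is additive, and it is linear over functions: replacing [Y] by [f Y] creates
    the two extra terms [<df /\ i_Y w, X>] and [w ([X,f] /\ Y)], which cancel because
    the axioms of the Schouten bracket force [[X,f] = (-1)^(k-1) i_df X].  A map that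
    is linear over functions is given pointwise by a form: if [phi] is a bump function
    supported in a chart with frame [e_I], then [phi^2 Y] is globally the sum of the
    [(phi Y^I) (phi e_I)].  Smoothness of the scalar, hence of the form, rests on [d]
    being independent of the chart, i.e., on [d] commuting with pullbacks. *)

(* The axioms of [br] and [nabla] speak of global smooth sections, so a local frame cannot be
   inserted into them. Every computation with a frame is therefore made with cut-off fields and read
   at the one point $p$ where the bump function is 1. This also shapes the formula for $[X,f]$: the
   bracket is explicit only on functions and vector fields. The route goes through $[f,\cdot]$,
   which is linear over functions because $[f,g]=0$; on a wedge product of vector fields the Leibniz
   rule makes it an antiderivation, like $-i_{df}$, and antisymmetry then returns to $[X,f]$. A
   section stores its value at $p$ in the basis of [chart_at p], a chart that may jump from point to
   point. Smoothness is thus visible only through components in a fixed chart, and [ext_d], which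
   changes chart with the point, has to be rewritten in that chart. The required naturality rests on
   the symmetry of second derivatives: the pullback of $dx^i$ by $T$ is $dT^i$, which is closed. *)
From Pilot Require Import Defs.
From mathcomp Require Import all_boot all_order all_algebra.
From mathcomp Require Import all_classical all_reals all_analysis.
From mathcomp Require Import ring lra zify.
Local Open Scope ring_scope.
Import Order.TTheory GRing.Theory Num.Theory.
Import numFieldNormedType.Exports.
Set Implicit Arguments.
Unset Strict Implicit.
Unset Printing Implicit Defensive.

(** * Exterior algebra *)

Section ExteriorAlgebra.
Import mathcomp.boot.finset Pilot.Defs.
Variables (R : realType) (n : nat).
Implicit Types (x y z w : ext R n) (I J K : {set 'I_n}).

Lemma ebaseE I J : (ebase I : ext R n) J = (J == I)%:R.
Proof. by rewrite ffunE. Qed.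

Lemma scaleE (a : R) x I : (a *: x) I = a * x I.
Proof. by rewrite ffunE. Qed.

Lemma ext_sumE (T : Type) (r : seq T) (P : pred T) (F : T -> ext R n) I :
  (\sum_(i <- r | P i) F i) I = \sum_(i <- r | P i) F i I.
Proof.
by apply: (big_morph (fun x : ext R n => x I)) => [x y|]; rewrite ffunE.
Qed.

Lemma ext_expand x : x = \sum_I (x I : R) *: ebase I.
Proof.
apply/ffunP => J; rewrite ext_sumE (bigD1 J)//= big1 => [|I IJ].
  by rewrite scaleE ebaseE eqxx mulr1 addr0.
by rewrite scaleE ebaseE eq_sym (negbTE IJ) mulr0.
Qed.

Lemma wedgeDl x y z : wedge (x + y) z = wedge x z + wedge y z.
Proof.
apply/ffunP => K; rewrite !ffunE -big_split; apply: eq_bigr => I _ /=.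
by rewrite !ffunE; ring.
Qed.

Lemma wedgeZl (a : R) x z : wedge (a *: x) z = a *: wedge x z.
Proof.
apply/ffunP => K; rewrite scaleE !ffunE mulr_sumr; apply: eq_bigr => I _.
by rewrite scaleE; ring.
Qed.

Lemma wedgeDr x y z : wedge x (y + z) = wedge x y + wedge x z.
Proof.
apply/ffunP => K; rewrite !ffunE -big_split; apply: eq_bigr => I _ /=.
by rewrite !ffunE; ring.
Qed.

Lemma wedgeZr (a : R) x z : wedge x (a *: z) = a *: wedge x z.
Proof.
apply/ffunP => K; rewrite scaleE !ffunE mulr_sumr; apply: eq_bigr => I _.
by rewrite scaleE; ring.
Qed.

Lemma wedge0l x : wedge 0 x = 0.
Proof. by have := wedgeZl 0 0 x; rewrite !scale0r. Qed.

Lemma wedge0r x : wedge x 0 = 0.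
Proof. by have := wedgeZr 0 x 0; rewrite !scale0r. Qed.

Lemma wedgeNl x z : wedge (- x) z = - wedge x z.
Proof. by rewrite -scaleN1r wedgeZl scaleN1r. Qed.

Lemma wedgeNr x z : wedge x (- z) = - wedge x z.
Proof. by rewrite -scaleN1r wedgeZr scaleN1r. Qed.

Lemma wedge_suml (T : Type) (r : seq T) (P : pred T) (F : T -> ext R n) y :
  wedge (\sum_(i <- r | P i) F i) y = \sum_(i <- r | P i) wedge (F i) y.
Proof.
exact: (big_morph (wedge^~ y) (fun a b => wedgeDl a b y) (wedge0l y)).
Qed.

Lemma wedge_sumr (T : Type) (r : seq T) (P : pred T) (F : T -> ext R n) y :
  wedge y (\sum_(i <- r | P i) F i) = \sum_(i <- r | P i) wedge y (F i).
Proof.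
exact: (big_morph (wedge y) (wedgeDr y) (wedge0r y)).
Qed.

(* [inversions] is defined as the cardinal of a classical set. *)
Lemma inversionsE I J :
  inversions I J = #|[set ij : 'I_n * 'I_n |
    [&& ij.1 \in I, ij.2 \in J & (ij.2 < ij.1)%N]]|.
Proof.
apply: eq_card => ij; rewrite [RHS]inE; apply/idP/idP => [/set_mem//|h].
exact: mem_set.
Qed.

Lemma inversionsU I J K : [disjoint I & J] ->
  (inversions (I :|: J) K = inversions I K + inversions J K)%N.
Proof.
move=> dIJ; rewrite !inversionsE -cardsUI.
rewrite [X in (_ + #|pred_of_set X|)%N](_ : _ = finset.set0) ?cards0 ?addn0.
  by apply: eq_card => -[i j]; rewrite !inE /= andb_orl.
apply/setP => -[i j]; rewrite !inE /=.
case: (boolP (i \in I)) => //= iI.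
by rewrite (disjointFr dIJ iI) //= andbF.
Qed.

Lemma inversionsUr I J K : [disjoint J & K] ->
  (inversions I (J :|: K) = inversions I J + inversions I K)%N.
Proof.
move=> dIJ; rewrite !inversionsE -cardsUI.
rewrite [X in (_ + #|pred_of_set X|)%N](_ : _ = finset.set0) ?cards0 ?addn0.
  by apply: eq_card => -[i j]; rewrite !inE /= andb_orl andb_orr.
apply/setP => -[i j]; rewrite !inE /=.
case: (boolP (j \in J)) => //= [iI|]; last by rewrite andbF.
by rewrite (disjointFr dIJ iI) /= !andbF.
Qed.

(** For disjoint sets, a pair $(i,j)$ of $I\times J$ has $i\ne j$, so it is counted on exactly one
    of the two sides. *)
Lemma inversions_swap I J : [disjoint I & J] ->
  (inversions I J + inversions J I = #|I| * #|J|)%N.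
Proof.
move=> dIJ; pose f (ij : 'I_n * 'I_n) := (ij.2, ij.1).
have fI : injective f by move=> [a b] [c d] [-> ->].
have fK A : f @: A = [set ij | f ij \in A].
  apply/setP => -[a b]; rewrite !inE; apply/imsetP/idP => [[[c d] ? [-> ->]]//|].
  by move=> ?; exists (b, a).
have -> : inversions J I = #|[set ij : 'I_n * 'I_n |
    [&& ij.1 \in I, ij.2 \in J & (ij.1 < ij.2)%N]]|.
  rewrite inversionsE -(card_imset _ fI) fK.
  by apply: eq_card => -[i j]; rewrite !inE /= andbCA.
rewrite -cardsX inversionsE -cardsUI.
rewrite [X in (_ + #|pred_of_set X|)%N](_ : _ = finset.set0) ?cards0 ?addn0.
  apply: eq_card => -[i j]; rewrite !inE /=.
  case: (boolP (i \in I)) => //=; case: (boolP (j \in J)) => //= jJ iI.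
  rewrite -neq_ltn; apply/eqP => /val_inj ij.
  by rewrite ij (disjointFr dIJ) in jJ.
apply/setP => -[i j]; rewrite !inE /=.
by case: (i \in I); case: (j \in J) => //=; case: ltngtP; rewrite ?andbF.
Qed.

Lemma wedge_ebase I J : wedge (ebase I) (ebase J) =
  if [disjoint I & J] then (-1 : R) ^+ inversions I J *: ebase (I :|: J) else 0.
Proof.
apply/ffunP => K; rewrite ffunE.
(* In the sum defining the coefficient at [K], only the splitting of [K] into [I] and [J] can
   contribute, and it exists only if [I] and [J] are disjoint with union [K]. *)
have E (L : {set 'I_n}) : L \subset K -> (L != I) || (K :\: L != J) ->
    (-1) ^+ inversions L (K :\: L) *
      ((ebase I : ext R n) L * (ebase J : ext R n) (K :\: L)) = 0.
  by rewrite !ebaseE => _ /orP[]/negbTE->; rewrite ?(mul0r,mulr0).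
case: ifPn => dIJ; last first.
  rewrite [RHS]ffunE big1 // => L LK; apply: (E L LK).
  rewrite -negb_and; apply: contra dIJ => /andP[/eqP <- /eqP <-].
  by rewrite disjoint_sym disjoints_subset setDE subsetIr.
rewrite scaleE ebaseE; have [KE|KN] := eqVneq K (I :|: J).
  subst K; rewrite (bigD1 I) ?subsetUl//= big1 ?addr0 => [|L /andP[L1 L2]].
    by rewrite setDUl setDv set0U (setDidPl _) 1?disjoint_sym// !ebaseE !eqxx !mulr1.
  by apply: (E L L1); rewrite L2.
rewrite big1 ?mulr0// => L LK; apply: (E L LK); rewrite -negb_and.
apply: contra KN => /andP[/eqP <- /eqP <-].
by rewrite setDE setUIr setUCr setIT; apply/eqP/esym/setUidPr.
Qed.

Lemma wedge1l x : wedge (ebase finset.set0) x = x.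
Proof.
rewrite [in RHS](ext_expand x) {1}(ext_expand x) wedge_sumr; apply: eq_bigr => I _.
rewrite wedgeZr wedge_ebase disjoints_subset sub0set set0U inversionsE.
rewrite [X in #|pred_of_set X|](_ : _ = finset.set0) ?cards0 ?expr0 ?scale1r//.
by apply/setP => ij; rewrite !inE.
Qed.

Lemma wedge1r x : wedge x (ebase finset.set0) = x.
Proof.
rewrite [in RHS](ext_expand x) {1}(ext_expand x) wedge_suml; apply: eq_bigr => I _.
rewrite wedgeZl wedge_ebase disjoint_sym disjoints_subset sub0set setU0 inversionsE.
rewrite [X in #|pred_of_set X|](_ : _ = finset.set0) ?cards0 ?expr0 ?scale1r//.
by apply/setP => ij; rewrite !inE /= andbF.
Qed.

Lemma disjointUl I J K :
  [disjoint I :|: J & K] = [disjoint I & K] && [disjoint J & K].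
Proof. by rewrite -!setI_eq0 setIUl setU_eq0. Qed.

Lemma disjointUr I J K :
  [disjoint I & J :|: K] = [disjoint I & J] && [disjoint I & K].
Proof. by rewrite -!setI_eq0 setIUr setU_eq0. Qed.

(** When the three sets are disjoint, either bracketing counts the inversions of the pairs $(I,J)$,
    $(I,K)$ and $(J,K)$ once each. *)
Lemma wedgeA_ebase I J K : wedge (ebase I) (wedge (ebase J) (ebase K)) =
  wedge (wedge (ebase I) (ebase J)) (ebase K) :> ext R n.
Proof.
rewrite !wedge_ebase.
have [dJK|dJK] := boolP [disjoint J & K]; have [dIJ|dIJ] := boolP [disjoint I & J];
  rewrite ?wedgeZr ?wedgeZl ?wedge_ebase ?disjointUl ?disjointUr ?dJK ?dIJ ?andbT /=;
  rewrite ?(wedge0l, wedge0r) ?(negbTE dIJ) ?(negbTE dJK) ?andbF ?scaler0 //.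
case: ifP => dIK; rewrite ?scaler0 // !scalerA -!exprD setUA.
by rewrite inversionsU // inversionsUr //; congr (_ ^+ _ *: _); lia.
Qed.

Lemma wedgeA x y z : wedge x (wedge y z) = wedge (wedge x y) z.
Proof.
have {1 2}-> := ext_expand x; rewrite !wedge_suml; apply: eq_bigr => I _.
have {1 2}-> := ext_expand y; rewrite !(wedge_suml, wedge_sumr).
apply: eq_bigr => J _.
have {1 2}-> := ext_expand z; rewrite !wedge_sumr; apply: eq_bigr => K _.
rewrite !(wedgeZl, wedgeZr) wedgeA_ebase !scalerA.
by congr (_ *: _); ring.
Qed.

Lemma homogE (k : nat) x I : homog k%:Z x -> #|I| != k -> x I = 0.
Proof.
move=> hx Ik; apply/eqP; apply: contraNT Ik => /hx [->//].
Qed.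

Lemma homog0 (k : int) : homog k (0 : ext R n).
Proof. by move=> I; rewrite ffunE eqxx. Qed.

Lemma homogD (k : int) x y : homog k x -> homog k y -> homog k (x + y).
Proof.
move=> hx hy I; rewrite ffunE.
have [->|/hx//] := eqVneq (x I) 0.
by rewrite add0r; exact: hy.
Qed.

Lemma homogZ (k : int) (a : R) x : homog k x -> homog k (a *: x).
Proof. by move=> hx I; rewrite scaleE mulf_eq0 negb_or => /andP[_ /hx]. Qed.

Lemma homog_sum (k : int) (T : Type) (r : seq T) (P : pred T) (F : T -> ext R n) :
  (forall i, P i -> homog k (F i)) -> homog k (\sum_(i <- r | P i) F i).
Proof. by move=> h; elim/big_ind : _ => //; [exact: homog0|exact: homogD]. Qed.

Lemma homog_ebase I : homog (#|I|)%:Z (ebase I : ext R n).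
Proof.
move=> J; have [->//|/negbTE JI] := eqVneq J I.
by rewrite ebaseE JI eqxx.
Qed.

Lemma homog_lt0 (k : int) x : (k < 0) -> homog k x -> x = 0.
Proof.
move=> k0 hx; apply/ffunP => I; rewrite ffunE; apply/eqP/negPn/negP => /hx E.
by rewrite -E in k0.
Qed.

Lemma homog_wedge (a b : int) x y :
  homog a x -> homog b y -> homog (a + b) (wedge x y).
Proof.
move=> hx hy K; rewrite ffunE => s0.
have [I /andP[IK]] : exists I, (I \subset K) &&
    ((-1) ^+ inversions I (K :\: I) * (x I * y (K :\: I)) != 0).
  apply: contrapT => h; case/negP: s0; apply/eqP/big1 => I IK.
  by apply/eqP/negPn/negP => ?; apply: h; exists I; rewrite IK.
rewrite mulf_eq0 negb_or => /andP[_]; rewrite mulf_eq0 negb_or => /andP[/hx <- /hy <-].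
by rewrite -(cardsID I K) (setIidPr IK).
Qed.

Lemma wedge_comm (a b : nat) x y : homog a%:Z x -> homog b%:Z y ->
  wedge x y = (-1 : R) ^+ (a * b) *: wedge y x.
Proof.
move=> hx hy.
have {2}-> : y = \sum_J (y J : R) *: ebase J by exact: ext_expand.
have {1}-> : y = \sum_J (y J : R) *: ebase J by exact: ext_expand.
rewrite wedge_sumr wedge_suml scaler_sumr; apply: eq_bigr => J _.
have {2}-> : x = \sum_J (x J : R) *: ebase J by exact: ext_expand.
have {1}-> : x = \sum_J (x J : R) *: ebase J by exact: ext_expand.
rewrite wedge_sumr wedge_suml scaler_sumr; apply: eq_bigr => I _.
rewrite !(wedgeZl, wedgeZr) !scalerA.
have [Ia|/(homogE hx)->] := eqVneq #|I| a; last by rewrite ?(mulr0,mul0r,scale0r).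
have [Jb|/(homogE hy)->] := eqVneq #|J| b; last by rewrite ?(mulr0,mul0r,scale0r).
rewrite !wedge_ebase disjoint_sym; case: ifP => dJI; last by rewrite !scaler0.
rewrite !scalerA setUC -Ia -Jb -inversions_swap 1?disjoint_sym// exprD.
(* Here [t] stands for the sign of one order of the factors: it enters twice, and [ring] alone does
   not know that its square is 1. *)
have E (u v s t : R) : t ^+ 2 = 1 -> u * v * s = s * t * v * u * t.
  by move=> tt; rewrite -[LHS]mulr1 -[X in _ * X = _]tt; ring.
congr (_ *: _); apply: (E (x I) (y J)); exact: sqrr_sign.
Qed.

Lemma pairingC w x : pairing w x = pairing x w.
Proof. by apply: eq_bigr => I _; rewrite mulrC. Qed.

Lemma pairing_ebase w I : pairing w (ebase I) = w I.
Proof.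
rewrite /pairing (bigD1 I)//= big1 ?ebaseE ?eqxx ?mulr1 ?addr0// => J JI.
by rewrite ebaseE (negbTE JI) mulr0.
Qed.

Lemma pairingDr w x y : pairing w (x + y) = pairing w x + pairing w y.
Proof.
by rewrite -big_split; apply: eq_bigr => I _; rewrite ffunE mulrDr.
Qed.

Lemma pairingDl w x y : pairing (x + y) w = pairing x w + pairing y w.
Proof. by rewrite -!(pairingC w) pairingDr. Qed.

Lemma pairingZr (a : R) w x : pairing w (a *: x) = a * pairing w x.
Proof. by rewrite mulr_sumr; apply: eq_bigr => I _; rewrite scaleE mulrCA. Qed.

Lemma pairingZl (a : R) w x : pairing (a *: w) x = a * pairing w x.
Proof. by rewrite pairingC pairingZr pairingC. Qed.

Lemma pairing0r w : pairing w 0 = 0.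
Proof. by have := pairingZr 0 w 0; rewrite scale0r mul0r. Qed.

Lemma pairing_sumr (T : Type) (r : seq T) (P : pred T) (F : T -> ext R n) w :
  pairing w (\sum_(i <- r | P i) F i) = \sum_(i <- r | P i) pairing w (F i).
Proof.
exact: (big_morph (pairing w) (pairingDr w) (pairing0r w)).
Qed.

Lemma pairing_inj x y : (forall z, pairing x z = pairing y z) -> x = y.
Proof. by move=> h; apply/ffunP => I; rewrite -!pairing_ebase h. Qed.

Lemma pairing_homog (a : int) w x : homog a w ->
  pairing w x = \sum_(I : {set 'I_n} | (#|I|)%:Z == a) w I * x I.
Proof.
move=> hw; rewrite /pairing [RHS]big_mkcond; apply: eq_bigr => J _.
by case: ifPn => // /eqP ja; have [->|/hw//] := eqVneq (w J) 0; rewrite mul0r.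
Qed.

Lemma pairing_neq (a b : int) w x :
  homog a w -> homog b x -> a != b -> pairing w x = 0.
Proof.
move=> hw hx ab; apply: big1 => I _.
have [->|/hw Ia] := eqVneq (w I) 0; first by rewrite mul0r.
have [->|/hx Ib] := eqVneq (x I) 0; first by rewrite mulr0.
by rewrite -Ia Ib eqxx in ab.
Qed.

(** Contraction is the transpose of the left wedge product. As [pairing] is symmetric, this serves
    equally to contract forms by vectors and vectors by covectors. *)
Lemma pairing_contract x w y : pairing (contract x w) y = pairing w (wedge x y).
Proof.
rewrite [in RHS](ext_expand y) wedge_sumr pairing_sumr; apply: eq_bigr => I _.
by rewrite ffunE wedgeZr pairingZr mulrC.
Qed.

Lemma contractDl x y w : contract (x + y) w = contract x w + contract y w.
Proof. by apply/ffunP => I; rewrite !ffunE wedgeDl pairingDr. Qed.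

Lemma contractZl (a : R) x w : contract (a *: x) w = a *: contract x w.
Proof. by apply/ffunP => I; rewrite !ffunE wedgeZl pairingZr. Qed.

Lemma contractDr x y w : contract w (x + y) = contract w x + contract w y.
Proof. by apply/ffunP => I; rewrite !ffunE pairingDl. Qed.

Lemma contractZr (a : R) x w : contract w (a *: x) = a *: contract w x.
Proof. by apply/ffunP => I; rewrite !ffunE pairingZl. Qed.

Lemma contract0r w : contract w 0 = 0.
Proof. by have := contractZr 0 0 w; rewrite !scale0r. Qed.

Lemma contract0l w : contract 0 w = 0.
Proof. by have := contractZl 0 0 w; rewrite !scale0r. Qed.

Lemma contract_sumr (T : Type) (r : seq T) (P : pred T) (F : T -> ext R n) w :
  contract w (\sum_(i <- r | P i) F i) = \sum_(i <- r | P i) contract w (F i).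
Proof.
exact: (big_morph (contract w) (fun x y => contractDr x y w) (contract0r w)).
Qed.

Lemma contract_suml (T : Type) (r : seq T) (P : pred T) (F : T -> ext R n) w :
  contract (\sum_(i <- r | P i) F i) w = \sum_(i <- r | P i) contract (F i) w.
Proof.
exact: (big_morph (contract^~ w) (fun x y => contractDl x y w) (contract0l w)).
Qed.

Lemma homog_contract (a b : int) x w :
  homog a x -> homog b w -> homog (b - a) (contract x w).
Proof.
move=> hx hw J; rewrite ffunE => h.
have [E|E] := eqVneq b (a + (#|J|)%:Z); first by rewrite E addrAC subrr add0r.
rewrite (@pairing_neq b (a + (#|J|)%:Z)) ?eqxx // in h.
by apply: homog_wedge => //; exact: homog_ebase.
Qed.

End ExteriorAlgebra.

(** * Induced maps on exterior powers *)

Section ExteriorMap.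
Import mathcomp.boot.finset Pilot.Defs.
Variables (R : realType) (n : nat).
Implicit Types (x y z w : ext R n) (I J K L : {set 'I_n}) (i j : 'I_n).
Implicit Types (A B : 'M[R]_n).

Lemma wedge_e1 i I : wedge (ebase [set i]) (ebase I) =
  if i \in I then 0 else (-1 : R) ^+ inversions [set i] I *: ebase (i |: I).
Proof.
by rewrite wedge_ebase disjoints_subset sub1set inE; case: (i \in I).
Qed.

Lemma contract_e1 i L : contract (ebase [set i]) (ebase L) =
  if i \in L then (-1 : R) ^+ inversions [set i] (L :\ i) *: ebase (L :\ i) else 0.
Proof.
apply/ffunP => J; rewrite ffunE wedge_e1.
have [iJ|iJ] := boolP (i \in J).
  rewrite pairing0r; case: ifPn => iL; last by rewrite ffunE.
  rewrite scaleE ebaseE (_ : (J == _) = false) ?mulr0 //.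
  by apply/eqP => JE; rewrite JE !inE eqxx in iJ.
rewrite pairingZr pairing_ebase ebaseE.
case: ifPn => iL; last first.
  rewrite [RHS]ffunE (_ : (_ == L) = false) ?mulr0 //.
  by apply: contraNF iL => /eqP <-; rewrite !inE eqxx.
rewrite scaleE ebaseE; have [->|JL] := eqVneq J (L :\ i).
  by rewrite setD1K // eqxx.
rewrite (_ : (_ == L) = false) ?mulr0 //.
by apply: contra_neqF JL => /eqP <-; rewrite setU1K.
Qed.

Lemma sign2 (m : nat) : (-1 : R) ^+ m * (-1) ^+ m = 1.
Proof. by rewrite -expr2 sqrr_sign. Qed.

Lemma ebase_rec i I : i \in I ->
  ebase I = (-1 : R) ^+ inversions [set i] (I :\ i) *:
              wedge (ebase [set i]) (ebase (I :\ i)) :> ext R n.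
Proof.
by move=> iI; rewrite wedge_e1 !inE eqxx /= setD1K // scalerA sign2 scale1r.
Qed.

(** The anticommutation relation of $i_{e_i}$ and $e_j\wedge$. In the last case, $i\ne j$ with $i\in
    L$ and $j\notin L$, the signs of the two sides differ by the inversions between $i$ and $j$:
    exactly one of the two orders is inverted, which produces the minus sign. *)
Lemma contract_wedge_ebase i j L :
  contract (ebase [set i]) (wedge (ebase [set j]) (ebase L)) =
  (i == j)%:R *: ebase L -
    wedge (ebase [set j]) (contract (ebase [set i]) (ebase L)) :> ext R n.
Proof.
rewrite contract_e1 wedge_e1; have [<-{j}|ij] := eqVneq i j.
  rewrite scale1r; case: ifPn => iL.
    rewrite contract0r wedgeZr wedge_e1 !inE eqxx /= setD1K // scalerA sign2.
    by rewrite scale1r subrr.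
  rewrite wedge0r subr0 contractZr contract_e1 !inE eqxx /= setU1K //.
  by rewrite scalerA sign2 scale1r.
rewrite scale0r add0r; case: ifPn => jL.
  rewrite contract0r; case: ifPn => iL; rewrite ?wedge0r ?oppr0 //.
  by rewrite wedgeZr wedge_e1 !inE jL eq_sym ij /= scaler0 oppr0.
rewrite contractZr contract_e1 !inE (negbTE ij) /=; case: ifPn => iL; last first.
  by rewrite wedge0r scaler0 oppr0.
rewrite wedgeZr wedge_e1 !inE (negbTE jL) andbF !scalerA -scaleNr.
have EL : (j |: L) :\ i = j |: (L :\ i).
  apply/setP => k; rewrite !inE; case: (eqVneq k j) => [->|]//=.
  by rewrite eq_sym ij.
rewrite EL; congr (_ *: _); set M := L :\ i.
have -> : L = i |: M by rewrite setD1K.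
have dM k : k \notin M -> [disjoint [set k] & M].
  by move=> kM; rewrite disjoints_subset sub1set inE.
rewrite !inversionsUr ?dM ?inE ?eqxx ?(negbTE jL) ?andbF // !exprD.
have := @inversions_swap n [set i] [set j].
rewrite disjoints_subset sub1set !inE ij !cards1 mul1n => /(_ isT).
set a := inversions [set i] [set j]; set b := inversions [set j] [set i].
move=> ab; have := exprD (-1 : R) a b; rewrite ab expr1 => E.
transitivity ((-1) ^+ a * (-1) ^+ b *
   ((-1) ^+ inversions [set j] M * (-1) ^+ inversions [set i] M) : R).
  by ring.
by rewrite -E; ring.
Qed.

Lemma contract_wedge i j x :
  contract (ebase [set i]) (wedge (ebase [set j]) x) =
  (i == j)%:R *: x - wedge (ebase [set j]) (contract (ebase [set i]) x).
Proof.
have {1 2 3}-> := ext_expand x; rewrite wedge_sumr !contract_sumr wedge_sumr.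
rewrite scaler_sumr -sumrB; apply: eq_bigr => L _.
rewrite !(wedgeZr, contractZr) contract_wedge_ebase scalerBr !scalerA.
by rewrite [x L * _]mulrC.
Qed.

(** The exterior algebra is generated from 1 by linear combinations and left products with basis
    vectors; multiplicative statements are thereby reduced to one vector factor. *)
Lemma ext_ind (P : ext R n -> Prop) : P (ebase set0) ->
  (forall x y, P x -> P y -> P (x + y)) -> (forall (a : R) x, P x -> P (a *: x)) ->
  (forall i x, P x -> P (wedge (ebase [set i]) x)) -> forall x, P x.
Proof.
move=> P1 PD PZ PW x.
have P0 : P 0 by rewrite -(scale0r (ebase set0)); exact: PZ.
rewrite (ext_expand x); apply: (big_ind P) => // I _; apply: (PZ).
have [m] := ubnP #|I|; elim: m I => // m IH I Im.
have [->//|/set0Pn[i iI]] := eqVneq I set0.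
rewrite (ebase_rec iI); apply: (PZ); apply: (PW); apply: IH.
by rewrite (cardsD1 i) iI in Im.
Qed.

Definition arow A i : ext R n := \sum_(j < n) (A i j : R) *: ebase [set j].

Lemma homog_arow A i : homog 1 (arow A i).
Proof.
by apply: homog_sum => j _; apply: homogZ; have := @homog_ebase R n [set j]; rewrite cards1.
Qed.

Lemma wedge_anticomm x y : homog 1 x -> homog 1 y -> wedge x y = - wedge y x.
Proof.
by move=> hx hy; rewrite (@wedge_comm _ _ 1 1 x y hx hy) muln1 expr1 scaleN1r.
Qed.

Lemma wedge_sq x : homog 1 x -> wedge x x = 0.
Proof.
move=> hx; have /eqP := wedge_anticomm hx hx.
rewrite -subr_eq0 opprK -mulr2n -scaler_nat scaler_eq0 pnatr_eq0 /=.
by move/eqP.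
Qed.

Lemma extmapD A x y : extmap A (x + y) = extmap A x + extmap A y.
Proof.
by rewrite -big_split; apply: eq_bigr => I _; rewrite ffunE scalerDl.
Qed.

Lemma extmapZ A (a : R) x : extmap A (a *: x) = a *: extmap A x.
Proof. by rewrite scaler_sumr; apply: eq_bigr => I _; rewrite scaleE scalerA. Qed.

Lemma extmap0 A : extmap A (0 : ext R n) = 0.
Proof. by have := extmapZ A 0 0; rewrite !scale0r. Qed.

Lemma extmapN A x : extmap A (- x) = - extmap A x.
Proof. by rewrite -scaleN1r extmapZ scaleN1r. Qed.

Lemma extmap_sum (T : Type) (r : seq T) (P : pred T) (F : T -> ext R n) A :
  extmap A (\sum_(i <- r | P i) F i) = \sum_(i <- r | P i) extmap A (F i).
Proof. exact: (big_morph (extmap A) (extmapD A) (extmap0 A)). Qed.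

Lemma extmap_ebase A I :
  extmap A (ebase I) = \big[wedge/ebase set0]_(i <- enum I) arow A i.
Proof.
rewrite /extmap (bigD1 I)//= big1 ?ebaseE ?eqxx ?scale1r ?addr0// => J JI.
by rewrite ebaseE (negbTE JI) scale0r.
Qed.

Lemma sorted_enum_set I : sorted (relpre val ltn) (enum I).
Proof.
rewrite {1}/enum_mem -enumT; apply: sorted_filter.
  by move=> a b c; exact: ltn_trans.
by rewrite -sorted_map val_enum_ord iota_ltn_sorted.
Qed.

(** Both lists are strictly increasing and have the same elements. *)
Lemma enum_setU1 i I : (forall j, j \in I -> (i < j)%N) ->
  enum (i |: I) = i :: enum I.
Proof.
move=> iI; apply: (irr_sorted_eq (leT := relpre val ltn)).
- by move=> a b c; exact: ltn_trans.
- by move=> a; exact: ltnn.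
- exact: sorted_enum_set.
- rewrite /= (path_sortedE (fun a b c => @ltn_trans _ _ _)) sorted_enum_set andbT.
  by apply/allP => j; rewrite mem_enum => /iI.
- by move=> j; rewrite mem_enum !inE mem_enum.
Qed.

Lemma extmap1 A : extmap A (ebase set0) = ebase set0 :> ext R n.
Proof. by rewrite extmap_ebase enum_set0 big_nil. Qed.

(** When $i$ precedes all of $I$ there are no inversions, and the ordered product defining [extmap]
    simply gains a first factor. *)
Lemma extmap_wedge_lt A i I : (forall j, j \in I -> (i < j)%N) ->
  extmap A (wedge (ebase [set i]) (ebase I)) = wedge (arow A i) (extmap A (ebase I)).
Proof.
move=> iI; have iNI : i \notin I by apply/negP => /iI; rewrite ltnn.
rewrite wedge_e1 (negbTE iNI) (_ : inversions _ _ = 0%N) ?expr0 ?scale1r.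
  by rewrite !extmap_ebase enum_setU1 // big_cons.
apply/eqP; rewrite inversionsE cards_eq0; apply/eqP/setP => -[a b]; rewrite !inE /=.
by apply/and3P => -[/eqP -> /iI ib bi]; have := ltn_trans ib bi; rewrite ltnn.
Qed.

Lemma extmap_wedge_ebase A i I :
  extmap A (wedge (ebase [set i]) (ebase I)) = wedge (arow A i) (extmap A (ebase I)).
Proof.
(* If [i] is not below the least element [k] of [I], exchange [e_i] and [e_k] on both
   sides: the remaining product starts with its least index. *)
have [m] := ubnP #|I|; elim: m i I => // m IH i I Im.
have [-> |/set0Pn[k0 k0I]] := eqVneq I set0.
  by apply: extmap_wedge_lt => j; rewrite inE.
pose k := [arg min_(j < k0 in I) (j : nat)].
have [kI kmin] : k \in I /\ forall j, j \in I -> (k <= j)%N.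
  by rewrite /k; case: arg_minnP.
have [ik|ki] := ltnP i k.
  by apply: extmap_wedge_lt => j jI; exact: leq_trans ik (kmin j jI).
set J := I :\ k; have kJ j : j \in J -> (k < j)%N.
  rewrite !inE => /andP[jk /kmin]; rewrite leq_eqVlt => /orP[/eqP/val_inj E|//].
  by rewrite E eqxx in jk.
have Jm : (#|J| < m)%N by rewrite (cardsD1 k) kI in Im.
have hA j : homog 1 (arow A j) by exact: homog_arow.
have he j : homog 1 (ebase [set j] : ext R n).
  by have := @homog_ebase R n [set j]; rewrite cards1.
rewrite (ebase_rec kI) -/J !(wedgeZr, extmapZ); congr (_ *: _).
rewrite (extmap_wedge_lt A kJ) !wedgeA.
have [->|ik] := eqVneq i k.
  by rewrite !wedge_sq // !wedge0l extmap0.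
rewrite (wedge_anticomm (he i) (he k)) (wedge_anticomm (hA i) (hA k)).
rewrite !wedgeNl extmapN -!wedgeA -IH //; congr (- _).
rewrite wedge_e1; case: ifPn => iJ; first by rewrite !(wedge0r, extmap0).
rewrite !(wedgeZr, extmapZ); congr (_ *: _); apply: extmap_wedge_lt => j.
rewrite !inE => /orP[/eqP->|]; last by move=> jJ; apply: kJ; rewrite !inE.
by rewrite ltn_neqAle ki andbT eq_sym.
Qed.

Lemma extmap_wedge_e A i x :
  extmap A (wedge (ebase [set i]) x) = wedge (arow A i) (extmap A x).
Proof.
have {1 2}-> := ext_expand x; rewrite wedge_sumr !extmap_sum wedge_sumr.
by apply: eq_bigr => I _; rewrite !(wedgeZr, extmapZ) extmap_wedge_ebase.
Qed.

Lemma extmap_wedge A x y : extmap A (wedge x y) = wedge (extmap A x) (extmap A y).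
Proof.
elim/ext_ind: x => [|x x' IH IH'|a x IH|i x IH].
- by rewrite extmap1 !wedge1l.
- by rewrite extmapD !wedgeDl extmapD IH IH'.
- by rewrite wedgeZl !extmapZ wedgeZl IH.
- by rewrite -wedgeA !extmap_wedge_e IH wedgeA.
Qed.

Lemma extmap_e A i : extmap A (ebase [set i]) = arow A i.
Proof. by rewrite -[ebase [set i]]wedge1r extmap_wedge_e extmap1 wedge1r. Qed.

Lemma extmap_comp A B x : extmap B (extmap A x) = extmap (A *m B) x.
Proof.
elim/ext_ind: x => [|x x' IH IH'|a x IH|i x IH].
- by rewrite !extmap1.
- by rewrite !extmapD IH IH'.
- by rewrite !extmapZ IH.
rewrite !extmap_wedge_e extmap_wedge IH; congr wedge.
rewrite extmap_sum /arow.
transitivity (\sum_(j < n) \sum_(k < n) (A i j * B j k : R) *: (ebase [set k] : ext R n)).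
  apply: eq_bigr => j _; rewrite extmapZ extmap_e scaler_sumr.
  by apply: eq_bigr => k _; rewrite scalerA.
by rewrite exchange_big; apply: eq_bigr => k _; rewrite mxE scaler_suml.
Qed.

Lemma extmap_id x : extmap 1%:M x = x.
Proof.
elim/ext_ind: x => [|x x' IH IH'|a x IH|i x IH].
- by rewrite !extmap1.
- by rewrite !extmapD IH IH'.
- by rewrite !extmapZ IH.
rewrite extmap_wedge_e IH; congr wedge.
rewrite /arow (bigD1 i)//= big1 => [|j ji]; rewrite mxE.
  by rewrite eqxx scale1r addr0.
by rewrite eq_sym (negbTE ji) scale0r.
Qed.

Lemma homog_extmap A (k : int) x : homog k x -> homog k (extmap A x).
Proof.
move=> hx; apply: homog_sum => I _.
have [->|/hx <-] := eqVneq (x I) 0; first by rewrite scale0r; exact: homog0.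
apply: homogZ; rewrite cardE; elim: (enum I) => [|i s IH].
  by rewrite big_nil; have := @homog_ebase R n set0; rewrite cards0.
rewrite big_cons /= -add1n PoszD; apply: homog_wedge => //; exact: homog_arow.
Qed.

(** The covector on the right is column [i] of [A], the pullback of $dx^i$. Both sides obey the same
    antiderivation rule under $e_k\wedge$, with the same scalar $A_{ki}$. *)
Lemma contract_extmap A i x : contract (ebase [set i]) (extmap A x) =
  extmap A (contract (\sum_(j < n) (A j i : R) *: ebase [set j]) x).
Proof.
elim/ext_ind: x => [|x x' IH IH'|a x IH|k x IH].
- rewrite extmap1 contract_suml contract_e1 inE big1 ?extmap0 // => j _.
  by rewrite contractZl contract_e1 inE scaler0.
- by rewrite extmapD !contractDr extmapD IH IH'.
- by rewrite extmapZ !contractZr extmapZ IH.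
rewrite extmap_wedge_e /arow wedge_suml contract_sumr.
transitivity ((A k i : R) *: extmap A x -
    wedge (arow A k) (contract (ebase [set i]) (extmap A x))).
  rewrite /arow wedge_suml.
  have {1}-> : A k i = \sum_(j < n) (A k j * (i == j)%:R).
    rewrite (bigD1 i)//= eqxx mulr1 big1 ?addr0// => j ji.
    by rewrite eq_sym (negbTE ji) mulr0.
  rewrite scaler_suml -sumrB; apply: eq_bigr => j _.
  by rewrite !wedgeZl contractZr contract_wedge scalerBr scalerA.
rewrite IH -extmap_wedge_e -extmapZ -extmapN -extmapD; congr (extmap A _).
rewrite !contract_suml wedge_sumr.
have {1}-> : A k i = \sum_(j < n) (A j i * (j == k)%:R).
  rewrite (bigD1 k)//= eqxx mulr1 big1 ?addr0// => j ji.
  by rewrite (negbTE ji) mulr0.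
rewrite scaler_suml -sumrB; apply: eq_bigr => j _.
by rewrite !contractZl contract_wedge scalerBr scalerA wedgeZr.
Qed.

(** The transpose of [extmap A]: when [A] is a Jacobian matrix, this is the pullback of forms, in
    the shape that occurs in [form_coord]. *)
Definition pull A w : ext R n := [ffun I : {set 'I_n} => pairing w (extmap A (ebase I))].

Lemma pairing_pull A w x : pairing (pull A w) x = pairing w (extmap A x).
Proof.
have {2}-> := ext_expand x; rewrite extmap_sum pairing_sumr; apply: eq_bigr => I _.
by rewrite ffunE extmapZ pairingZr mulrC.
Qed.

Lemma pull_comp A B w : pull A (pull B w) = pull (A *m B) w.
Proof. by apply: pairing_inj => z; rewrite !pairing_pull extmap_comp. Qed.

Lemma pull_id w : pull 1%:M w = w.
Proof. by apply: pairing_inj => z; rewrite !pairing_pull extmap_id. Qed.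

Lemma pullD A x y : pull A (x + y) = pull A x + pull A y.
Proof. by apply/ffunP => I; rewrite !ffunE pairingDl. Qed.

Lemma pullZ A (a : R) x : pull A (a *: x) = a *: pull A x.
Proof. by apply/ffunP => I; rewrite !ffunE pairingZl. Qed.

Lemma pull0 A : pull A 0 = 0.
Proof. by have := pullZ A 0 0; rewrite !scale0r. Qed.

Lemma pull_sum (T : Type) (r : seq T) (P : pred T) (F : T -> ext R n) A :
  pull A (\sum_(i <- r | P i) F i) = \sum_(i <- r | P i) pull A (F i).
Proof. exact: (big_morph (pull A) (pullD A) (pull0 A)). Qed.

Lemma homog_pull A (k : int) w : homog k w -> homog k (pull A w).
Proof.
move=> hw I; rewrite ffunE => h; apply/eqP; apply: contraNT h => Ik.
rewrite eq_sym in Ik; apply/eqP/(pairing_neq hw _ Ik)/homog_extmap.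
exact: homog_ebase.
Qed.

Lemma pull1 A : pull A (ebase set0) = ebase set0.
Proof.
have h : homog 0 (pull A (ebase set0)).
  by apply: homog_pull; have := @homog_ebase R n set0; rewrite cards0.
apply/ffunP => I; have [->|I0] := eqVneq I set0.
  by rewrite ffunE extmap1 pairing_ebase.
rewrite (homogE h) ?ebaseE ?(negbTE I0) //.
by rewrite cards_eq0.
Qed.

(** The transpose of [contract_extmap]: against the pairing, wedging with a covector becomes
    contracting by it. *)
Lemma pull_wedge_e A i w : pull A (wedge (ebase [set i]) w) =
  wedge (\sum_(j < n) (A j i : R) *: ebase [set j]) (pull A w).
Proof.
apply: pairing_inj => z; rewrite pairing_pull.
by rewrite pairingC -pairing_contract pairingC contract_extmap -pairing_pull
  pairingC pairing_contract pairingC.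
Qed.

End ExteriorMap.

Local Open Scope classical_set_scope.

(** * Smooth functions of several variables *)

Section Locality.
Variables (R : realType) (V W : normedModType R).

(** The first-order expansion of [f] at [x] is also one of [g], and uniqueness of the differential
    identifies its linear part with ['d g x]. *)
Lemma near_eq_differentiable (f g : V -> W) x :
  (\near x, f x = g x) -> differentiable f x -> differentiable g x.
Proof.
move=> fg df; have [dfc dfx] := (diff_locallyP _ _).1 df.
have gx : g \o shift x = cst (g x) + 'd f x +o_ 0 id.
  have fx := nbhs_singleton fg.
  apply/eqaddoP => _/posnumP[e].
  have /eqaddoP /(_ e%:num) /(_ [gt0 of e%:num]) := dfx.
  have fg0 : \forall h \near (0 : V), f (h + x) = g (h + x).
    by move: fg; rewrite (near_shift 0 x) /= subr0.
  by apply: filterS2 fg0 => h /= fgh; rewrite !fctE /= fgh fx.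
have dE := diff_unique dfc gx.
by apply/diff_locallyP; rewrite dE.
Qed.

Lemma near_eq_continuous (f g : V -> W) x :
  (\near x, f x = g x) -> {for x, continuous f} -> {for x, continuous g}.
Proof.
move=> fg cf; rewrite /prop_for /continuous_at -(nbhs_singleton fg).
by apply: cvg_trans cf; exact: near_eq_cvg.
Qed.

End Locality.

Section Rows.
Variables (R : realType) (V : normedModType R) (m : nat).

Lemma differentiable_row (T : V -> 'rV[R]_m) x :
  (forall j, differentiable (fun u => T u ord0 j) x) -> differentiable T x.
Proof.
move=> dT; have -> : T = \sum_(j < m) (fun u => T u ord0 j *: delta_mx ord0 j).
  by apply/funext => u; rewrite fct_sumE -row_sum_delta.
by apply: differentiable_sum => j; exact: differentiableZl.
Qed.

End Rows.

Local Notation e_ i := (delta_mx ord0 i).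

Section Smooth.
Variables (R : realType) (n : nat).
Implicit Types (D : set 'rV[R]_n) (f g : 'rV[R]_n -> R).

Lemma open_near D (P : 'rV[R]_n -> Prop) u :
  open D -> D u -> (forall v, D v -> P v) -> \near u, P u.
Proof. by move=> oD Du DP; apply: filterS DP _; exact: open_nbhs_nbhs. Qed.

Lemma ndifferentiable_eq r D f g : open D -> (forall u, D u -> f u = g u) ->
  ndifferentiable r D f -> ndifferentiable r D g.
Proof.
move=> oD; elim: r f g => [|r IH] f g fg /=.
  move=> cf u uD; have Du := set_mem uD.
  by apply: near_eq_continuous (cf u uD); exact: open_near oD Du fg.
move=> [df Df]; split=> [u Du|i].
  by apply: near_eq_differentiable (df u Du); exact: open_near oD Du fg.
apply: IH (Df i) => u Du; apply: near_eq_derive; exact: open_near oD Du fg.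
Qed.

Lemma ndifferentiableW r D f : ndifferentiable r.+1 D f -> ndifferentiable r D f.
Proof.
elim: r f => [|r IH] f [df Df].
  by move=> u /set_mem Du; apply: differentiable_continuous; exact: df.
by split=> // i; apply: IH; exact: Df.
Qed.

Lemma ndifferentiable_sub r D D' f : D `<=` D' ->
  ndifferentiable r D' f -> ndifferentiable r D f.
Proof.
move=> DD'; elim: r f => [|r IH] f /=.
  by move=> cf u /set_mem Du; apply: cf; apply/mem_set/DD'.
by move=> [df Df]; split=> [u /DD'/df//|i]; apply: IH; exact: Df.
Qed.

(** Continuity and differentiability are required at each point of [D] with respect to all of
    $\mathbb{R}^n$, so the condition is a conjunction over points and a different [D'] may serve
    each of them. *)
Lemma ndifferentiable_local r D f :
  (forall u, D u -> exists2 D', D' u & ndifferentiable r D' f) ->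
  ndifferentiable r D f.
Proof.
elim: r f => [|r IH] f h /=.
  by move=> u /set_mem /h [D' D'u]; apply; exact: mem_set.
split=> [u /h[D' D'u [df _]]|i]; first exact: df.
by apply: IH => u /h[D' D'u [_ Df]]; exists D' => //; exact: Df.
Qed.

Lemma ndifferentiable_cst r D (a : R) : ndifferentiable r D (fun=> a).
Proof.
elim: r a => [|r IH] a /=; first by move=> u _; exact: cst_continuous.
split=> [u _|i]; first exact: differentiable_cst.
rewrite (_ : derive _ ^~ _ = fun=> 0) //.
by apply/funext => u; rewrite derive_cst.
Qed.

Lemma ndifferentiableD r D f g : open D ->
  ndifferentiable r D f -> ndifferentiable r D g ->
  ndifferentiable r D (fun u => f u + g u).
Proof.
move=> oD; elim: r f g => [|r IH] f g /=.
  by move=> cf cg u uD; apply: continuousD; [exact: cf|exact: cg].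
move=> [df Df] [dg Dg]; split=> [u Du|i].
  by apply: differentiableD; [exact: df|exact: dg].
apply: ndifferentiable_eq (IH _ _ (Df i) (Dg i)) => // u Du.
by rewrite -deriveD //; apply: diff_derivable; [exact: df|exact: dg].
Qed.

Lemma ndifferentiableM r D f g : open D ->
  ndifferentiable r D f -> ndifferentiable r D g ->
  ndifferentiable r D (fun u => f u * g u).
Proof.
move=> oD; elim: r f g => [|r IH] f g.
  by move=> cf cg u uD; apply: continuousM; [exact: cf|exact: cg].
move=> fr gr; have [df Df] := fr; have [dg Dg] := gr; split=> [u Du|i].
  by apply: differentiableM; [exact: df|exact: dg].
have := ndifferentiableD oD (IH _ _ (ndifferentiableW fr) (Dg i))
  (IH _ _ (ndifferentiableW gr) (Df i)).
apply: ndifferentiable_eq => // u Du.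
by rewrite (deriveM (f := f) (g := g)) //; apply: diff_derivable; [exact: df|exact: dg].
Qed.

Lemma ndifferentiable_sum r D (I : Type) (s : seq I) (P : pred I)
    (F : I -> 'rV[R]_n -> R) : open D ->
  (forall i, P i -> ndifferentiable r D (F i)) ->
  ndifferentiable r D (fun u => \sum_(i <- s | P i) F i u).
Proof.
move=> oD h; elim: s => [|i s IH].
  rewrite (_ : (fun _ => _) = fun=> 0); first exact: ndifferentiable_cst.
  by apply/funext => u; rewrite big_nil.
have [Pi|Pi] := boolP (P i); last first.
  rewrite (_ : (fun _ => _) = fun u => \sum_(i <- s | P i) F i u) //.
  by apply/funext => u; rewrite big_cons (negbTE Pi).
rewrite (_ : (fun _ => _) = fun u => F i u + \sum_(i <- s | P i) F i u).
  by apply: ndifferentiableD => //; exact: h.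
by apply/funext => u; rewrite big_cons Pi.
Qed.

Lemma ndifferentiableV r D f : open D -> (forall u, D u -> f u != 0) ->
  ndifferentiable r D f -> ndifferentiable r D (fun u => (f u)^-1).
Proof.
move=> oD f0; elim: r => [|r IH].
  by move=> cf u uD; apply: continuousV; [exact/f0/set_mem|exact: cf].
move=> fr; have [df Df] := fr; split=> [u Du|i].
  by apply: differentiableV; [exact: df|exact: f0].
have fr' := IH (ndifferentiableW fr).
have := ndifferentiableM oD (ndifferentiable_cst r D (-1))
  (ndifferentiableM oD (ndifferentiableM oD fr' fr') (Df i)).
apply: ndifferentiable_eq => // u Du.
rewrite deriveV ?f0 //; last by apply: diff_derivable; exact: df.
by rewrite expr2 invfM -[_ *: _]/(_ * _); ring.
Qed.

Lemma differentiable_coord0 (j : 'I_n) (u : 'rV[R]_n) :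
  differentiable (fun u : 'rV[R]_n => u ord0 j) u.
Proof. exact: differentiable_coord. Qed.

Lemma derive_coord (i j : 'I_n) (u : 'rV[R]_n) :
  'D_(e_ i) (fun u : 'rV[R]_n => u ord0 j) u = (j == i)%:R.
Proof.
have dv : derivable (id : 'rV[R]_n -> 'rV[R]_n) u (e_ i) by exact: derivable_id.
have := derive_mx dv; rewrite derive_id => /matrixP/(_ ord0 j).
by rewrite !mxE eqxx => <-.
Qed.

Lemma ndifferentiable_coord r D (j : 'I_n) :
  ndifferentiable r D (fun u => u ord0 j).
Proof.
case: r => [|r] /=.
  by move=> u _; apply: differentiable_continuous; exact: differentiable_coord0.
split=> [u _|i]; first exact: differentiable_coord0.
rewrite (_ : derive _ ^~ _ = fun=> (j == i)%:R : R); first exact: ndifferentiable_cst.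
by apply/funext => u; rewrite derive_coord.
Qed.

Lemma smooth_differentiable D f u : smooth_on D f -> D u -> differentiable f u.
Proof. by move=> /(_ 1%N)[df _]; exact: df. Qed.

Lemma smooth_derive D f i : smooth_on D f -> smooth_on D ('D_(e_ i) f).
Proof. by move=> sf r; have [_] := sf r.+1; exact. Qed.

Lemma smooth_continuous D f u : smooth_on D f -> D u -> {for u, continuous f}.
Proof. by move=> /(_ 0%N) cf Du; apply: cf; exact: mem_set. Qed.

End Smooth.

Section ChainRule.
Variables (R : realType) (n m : nat).

Lemma derive_comp_row (T : 'rV[R]_n -> 'rV[R]_m) (f : 'rV[R]_m -> R) u i :
  differentiable T u -> differentiable f (T u) ->
  'D_(e_ i) (f \o T) u =
    \sum_(j < m) 'D_(e_ j) f (T u) * 'D_(e_ i) (fun v => T v ord0 j) u.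
Proof.
move=> dT df; rewrite deriveE; last exact: differentiable_comp.
rewrite diff_comp //= -(deriveE _ dT) (row_sum_delta ('D_(e_ i) T u)) linear_sum.
apply: eq_bigr => j _; rewrite linearZ /= -deriveE // -[_ *: _]/(_ * _) mulrC.
by rewrite derive_mx ?mxE //; exact: diff_derivable.
Qed.

(** By the chain rule a partial derivative of $f\circ T$ is a sum of products of $(\partial_jf)\circ
    T$, to which the induction applies, with partial derivatives of $T$, which are smooth to every
    order. *)
Lemma ndifferentiable_comp r (D : set 'rV[R]_n) (D' : set 'rV[R]_m)
    (T : 'rV[R]_n -> 'rV[R]_m) (f : 'rV[R]_m -> R) : open D -> open D' ->
  (forall u, D u -> D' (T u)) -> (forall j, smooth_on D (fun u => T u ord0 j)) ->
  ndifferentiable r D' f -> ndifferentiable r D (f \o T).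
Proof.
move=> oD oD' TD sT.
have dT u : D u -> differentiable T u.
  by move=> Du; apply: differentiable_row => j; exact: smooth_differentiable (sT j) Du.
elim: r f => [|r IH] f.
  move=> cf u /set_mem Du; apply: continuous_comp.
    by apply: differentiable_continuous; exact: dT.
  by apply: cf; apply: mem_set; exact: TD.
move=> [df Df]; split=> [u Du|i].
  by apply: differentiable_comp; [exact: dT|apply: df; exact: TD].
have : ndifferentiable r D (fun u => \sum_(j < m)
    ('D_(e_ j) f \o T) u * 'D_(e_ i) (fun v => T v ord0 j) u).
  apply: ndifferentiable_sum => // j _; apply: ndifferentiableM => //.
    by apply: IH; exact: Df.
  exact: smooth_derive.
apply: ndifferentiable_eq => // u Du; rewrite derive_comp_row //; first exact: dT.
by apply: df; exact: TD.
Qed.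

Lemma smooth_comp (D : set 'rV[R]_n) (D' : set 'rV[R]_m)
    (T : 'rV[R]_n -> 'rV[R]_m) (f : 'rV[R]_m -> R) : open D -> open D' ->
  (forall u, D u -> D' (T u)) -> (forall j, smooth_on D (fun u => T u ord0 j)) ->
  smooth_on D' f -> smooth_on D (f \o T).
Proof.
by move=> oD oD' TD sT sf r; apply: ndifferentiable_comp oD oD' TD sT _; exact: sf.
Qed.

End ChainRule.

(** * Symmetry of second derivatives *)

Section Schwarz.
Variables (R : realType) (n : nat).
Implicit Types (D : set 'rV[R]_n) (f g : 'rV[R]_n -> R).

Lemma is_derive_line (f : 'rV[R]_n -> R) (u v : 'rV[R]_n) (s : R) :
  differentiable f (u + s *: v) ->
  is_derive s 1 (fun s => f (u + s *: v)) ('D_v f (u + s *: v)).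
Proof.
move=> df; pose l (s : R) := u + s *: v.
have dl : is_diff s l (fun s : R => s *: v).
  have -> : (fun s : R => s *: v) = (fun=> 0) + (fun s : R => s *: v).
    by apply/funext => t; rewrite !fctE add0r.
  exact: is_diffD.
have dfl : differentiable (f \o l) s by exact: differentiable_comp.
apply: DeriveDef; first exact: diff_derivable.
have dcE : 'd (f \o l) s = 'd f (l s) \o 'd l s :> (R -> R) by exact: diff_comp.
by rewrite deriveE // dcE /= diff_val scale1r deriveE.
Qed.

(* The left-hand side is symmetric in [a] and [b]; hence the symmetry of second
   derivatives as [s] tends to 0. *)
Lemma double_difference f (u a b : 'rV[R]_n) (s : R) : 0 < s ->
  (forall x y, 0 <= x <= s -> 0 <= y <= s ->
     differentiable f (u + x *: a + y *: b) /\
     differentiable ('D_a f) (u + x *: a + y *: b)) ->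
  exists x y, [/\ 0 <= x <= s, 0 <= y <= s &
    f (u + s *: a + s *: b) - f (u + s *: a) - (f (u + s *: b) - f u) =
    s * s * 'D_b ('D_a f) (u + x *: a + y *: b)].
Proof.
move=> s0 df.
have s0s : 0 <= s <= s by rewrite (ltW s0) lexx.
have s00 : 0 <= (0 : R) <= s by rewrite lexx (ltW s0).
have swap x y : u + x *: a + y *: b = u + y *: b + x *: a by rewrite addrAC.
(* The double difference is [phi s - phi 0]. One mean value theorem, for [phi], yields a difference
   of values of ['D_a f]; a second one, for [psi], turns it into a second derivative. *)
pose phi x := f (u + s *: b + x *: a) - f (u + x *: a).
have dphi x : 0 <= x <= s -> is_derive x 1 phi
    ('D_a f (u + s *: b + x *: a) - 'D_a f (u + x *: a)).
  move=> xs; apply: is_deriveB; apply: is_derive_line.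
    by rewrite -swap; case: (df x s).
  by have [+ _] := df x 0 xs s00; rewrite scale0r addr0.
have [x xs phiE] : exists2 x, 0 <= x <= s & phi s - phi 0 =
    ('D_a f (u + s *: b + x *: a) - 'D_a f (u + x *: a)) * (s - 0).
  have [||x xs E] := MVT s0 (df := fun x =>
      'D_a f (u + s *: b + x *: a) - 'D_a f (u + x *: a)) (f := phi).
  - by move=> x; rewrite in_itv /= => /andP[/ltW x0 /ltW xs]; apply: dphi; rewrite x0.
  - apply: derivable_within_continuous => x; rewrite in_itv /= => xs.
    exact: (@ex_derive _ _ _ _ _ _ _ (dphi x xs)).
  by exists x => //; move: xs; rewrite in_itv /= => /andP[/ltW-> /ltW->].
pose psi y := 'D_a f (u + x *: a + y *: b).
have dpsi y : 0 <= y <= s ->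
    is_derive y 1 psi ('D_b ('D_a f) (u + x *: a + y *: b)).
  by move=> ys; apply: is_derive_line; case: (df x y).
have [y ys psiE] : exists2 y, 0 <= y <= s & psi s - psi 0 =
    'D_b ('D_a f) (u + x *: a + y *: b) * (s - 0).
  have [||y ys E] := MVT s0 (df := fun y => 'D_b ('D_a f) (u + x *: a + y *: b))
    (f := psi).
  - by move=> y; rewrite in_itv /= => /andP[/ltW y0 /ltW ys]; apply: dpsi; rewrite y0.
  - apply: derivable_within_continuous => y; rewrite in_itv /= => ys.
    exact: (@ex_derive _ _ _ _ _ _ _ (dpsi y ys)).
  by exists y => //; move: ys; rewrite in_itv /= => /andP[/ltW-> /ltW->].
exists x, y; split=> //.
move: phiE psiE; rewrite /phi /psi !scale0r !addr0 !subr0 !(swap _ s) => -> ->.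
by ring.
Qed.

(** On a small parallelogram at [u], the double difference divided by $s^2$ is a value of each of
    the two mixed derivatives at nearby points. By continuity, both are within [e / 2] of their
    values at [u]. *)
Lemma derive_swap D f (a b u : 'rV[R]_n) : open D -> D u ->
  (forall v, D v -> differentiable f v /\
     [/\ differentiable ('D_a f) v, differentiable ('D_b f) v,
         {for v, continuous ('D_a ('D_b f))} &
         {for v, continuous ('D_b ('D_a f))}]) ->
  'D_a ('D_b f) u = 'D_b ('D_a f) u.
Proof.
have close (p q r e : R) : `|p - r| < e / 2 -> `|q - r| < e / 2 -> `|p - q| <= e.
  move=> pr qr; rewrite (le_trans (ler_distD r _ _)) // (splitr e).
  by rewrite lerD ?ltW // distrC.
move=> oD Du df; apply/eqP; rewrite -subr_eq0 -normr_le0.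
apply/ler_addgt0Pl => e e0; rewrite addr0.
have e20 : 0 < e / 2 by rewrite divr_gt0.
have [_ [_ _ cab cba]] := df u Du.
have nab : nbhs u (fun v => `|'D_a ('D_b f) u - 'D_a ('D_b f) v| < e / 2).
  by move/pseudometric_normed_Zmodule.cvgrPdist_lt : cab => /(_ _ e20).
have nba : nbhs u (fun v => `|'D_b ('D_a f) u - 'D_b ('D_a f) v| < e / 2).
  by move/pseudometric_normed_Zmodule.cvgrPdist_lt : cba => /(_ _ e20).
have nuF : Filter (nbhs u) by exact: nbhs_filter.
have nu := @filterI _ _ nuF _ _ (open_nbhs_nbhs (conj oD Du))
  (@filterI _ _ nuF _ _ nab nba).
have [d /= d0 dB] := (nbhs_ballP _ _).1 nu.
(* With $s=d/N$ the parallelogram has radius at most $s(|a|+|b|)<d$; the summand 1 makes the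
   inequality strict and keeps [N] positive when $a=b=0$. *)
pose N := `|a| + `|b| + 1; have N0 : 0 < N by rewrite ltr_wpDl ?addr_ge0.
pose s := d / N; have s0 : 0 < s by rewrite divr_gt0.
have inB x y : 0 <= x <= s -> 0 <= y <= s -> ball u d (u + x *: a + y *: b).
  move=> /andP[x0 xs] /andP[y0 ys]; rewrite -ball_normE /= -addrA opprD addrA subrr.
  rewrite sub0r normrN (le_lt_trans (ler_normD _ _)) // !normrZ !ger0_norm //.
  have -> : d = s * N by rewrite mulfVK // gt_eqF.
  rewrite /N !mulrDr mulr1 ltr_pwDr // lerD //; exact: ler_wpM2r.
have [x [y [xs ys E1]]] := double_difference s0 (fun p q ps qs =>
  let: conj d0 (And4 d1 _ _ _) := df _ (dB _ (inB p q ps qs)).1 in conj d0 d1).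
have inB' p q : 0 <= p <= s -> 0 <= q <= s -> ball u d (u + p *: b + q *: a).
  by move=> ps qs; rewrite addrAC; exact: inB.
have [x' [y' [xs' ys' E2]]] := double_difference s0 (fun p q ps qs =>
  let: conj d0 (And4 _ d1 _ _) := df _ (dB _ (inB' p q ps qs)).1 in conj d0 d1).
have PQ : 'D_b ('D_a f) (u + x *: a + y *: b) = 'D_a ('D_b f) (u + x' *: b + y' *: a).
  apply: (@mulfI _ (s * s)); first by rewrite mulf_neq0 // gt_eqF.
  have four (p q r t : R) : p - q - (r - t) = p - r - (q - t) by ring.
  rewrite -[LHS]E1 -[RHS]E2 (_ : u + s *: b + s *: a = u + s *: a + s *: b).
    exact: four.
  by rewrite addrAC.
have [_ [_ Q]] := dB _ (inB x y xs ys); have [_ [P _]] := dB _ (inB' x' y' xs' ys').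
move: P Q => /= P Q; rewrite -PQ in P.
exact: close P Q.
Qed.

Lemma smooth_swap D f i j u : open D -> smooth_on D f -> D u ->
  'D_(e_ i) ('D_(e_ j) f) u = 'D_(e_ j) ('D_(e_ i) f) u.
Proof.
move=> oD sf Du; apply: (derive_swap oD Du) => v Dv; split.
  exact: smooth_differentiable sf Dv.
split.
- exact: smooth_differentiable (smooth_derive i sf) Dv.
- exact: smooth_differentiable (smooth_derive j sf) Dv.
- exact: smooth_continuous (smooth_derive i (smooth_derive j sf)) Dv.
- exact: smooth_continuous (smooth_derive j (smooth_derive i sf)) Dv.
Qed.

End Schwarz.

(** * Bump functions *)

Section Bump.
Variable R : realType.
Implicit Types (s t : R) (k : nat).

(* The derivatives of [exp (-1/s)] are combinations of these functions. *)
Definition flat k s : R := if 0 < s then s ^- k * expR (- s^-1) else 0.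

Lemma flat_le0 k s : s <= 0 -> flat k s = 0.
Proof. by move=> s0; rewrite /flat ltNge s0. Qed.

(** For $s>0$ the exponential series gives $s^{-(k+1)}\le(k+1)!\,e^{1/s}$. Using the power $k+1$
    instead of $k$ leaves a factor $s$, hence the limit 0 at the origin. *)
Lemma flat_bound k s : `|flat k s| <= k.+1`!%:R * `|s|.
Proof.
have [s0|s0] := ltP 0 s; last by rewrite flat_le0 // normr0 mulr_ge0.
rewrite /flat s0 !gtr0_norm ?mulr_gt0 ?invr_gt0 ?exprn_gt0 ?expR_gt0 //.
rewrite expRN ler_pdivrMr ?expR_gt0 //.
have si0 : 0 <= s^-1 by rewrite invr_ge0 ltW.
have /(le_trans _) h := expR_ge1Dxn k si0.
have : s^-1 ^+ k.+1 / k.+1`!%:R <= expR s^-1 by apply: h; rewrite lerDr.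
rewrite ler_pdivrMr ?ltr0n ?fact_gt0 // => {}h.
have -> : s ^- k = s * s^-1 ^+ k.+1 by rewrite exprS mulVKf ?gt_eqF // exprVn.
by rewrite -mulrA mulrCA ler_pM2l // mulrC.
Qed.

Lemma flat_derive k s : is_derive s 1 (flat k) (flat k.+2 s - k%:R * flat k.+1 s).
Proof.
have [s0|s0|->] := ltgtP s 0.
- rewrite !flat_le0 ?(ltW s0) // mulr0 subr0.
  apply: (near_eq_is_derive (f := fun=> 0)).
  by near=> t; rewrite flat_le0 // ltW //; near: t; exact: lt_nbhsl.
- have E t : 0 < t -> flat k t = t^-1 ^+ k * expR (- t^-1).
    by move=> t0; rewrite /flat t0 exprVn.
  apply: (near_eq_is_derive (f := fun t => t^-1 ^+ k * expR (- t^-1))).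
    by near=> t; apply/esym/E; near: t; exact: lt_nbhsr.
  have sn0 : s != 0 by rewrite gt_eqF.
  have dV : is_derive s 1 (fun t : R => t^-1) (- s ^- 2).
    by apply: is_derive_eq; [exact: is_deriveV|rewrite scaler1].
  have dN : is_derive s 1 (fun t : R => - t^-1) (s ^- 2).
    by have := is_deriveN dV; rewrite opprK.
  have dE : is_derive s 1 (expR \o (fun t : R => - t^-1)) (expR (- s^-1) * s ^- 2).
    exact: is_derive1_comp.
  have dX := @is_deriveX _ _ (fun t : R => t^-1) k s 1 _ dV.
  rewrite (_ : (fun _ => _) = (fun t : R => t^-1) ^+ k * (expR \o (fun t : R => - t^-1))).
    2: by apply/funext => t; rewrite exprfctE.
  apply: (is_derive_eq (is_deriveM dX dE)).
  rewrite /= !fctE /flat s0 -!exprVn /GRing.scale /=.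
  case: k {E dX} => [|k] /=; rewrite !exprS; ring.
- rewrite !flat_le0 // mulr0 subr0.
  (* At the origin the difference quotient of [flat k] is [flat k.+1] itself, which tends to 0 by
     [flat_bound]. *)
  have E : (fun h : R => h^-1 *: ((flat k \o shift 0) (h *: 1) - flat k 0)) =
      flat k.+1.
    apply/funext => h; rewrite /= addr0 [h *: 1]mulr1 (flat_le0 _ (lexx 0)) subr0.
    have [h0|h0] := ltP 0 h; last by rewrite !flat_le0 // scaler0.
    by rewrite /flat h0 -!exprVn exprS -mulrA.
  have cv : flat k.+1 x @[x --> 0^'] --> (0 : R).
    apply/cvgr0Pnorm_le => e e0.
    have d0 : 0 < e / k.+2`!%:R by rewrite divr_gt0 // ltr0n fact_gt0.
    near=> h; apply: (le_trans (flat_bound _ _)).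
    rewrite -ler_pdivlMl ?ltr0n ?fact_gt0 // mulrC ltW //.
    by near: h; exact: dnbhs0_lt.
  by apply: DeriveDef; [apply/cvg_ex; exists 0; rewrite E|rewrite /derive E; exact/cvg_lim].
Unshelve. all: by end_near. Qed.

Variable n : nat.
Implicit Types (D : set 'rV[R]_n).

(** The induction on [r] runs over all [k] at once, because the derivative of [flat k] involves
    [flat k.+1] and [flat k.+2]. *)
Lemma ndifferentiable_flat r k D (g : 'rV[R]_n -> R) : open D -> smooth_on D g ->
  ndifferentiable r D (flat k \o g).
Proof.
move=> oD sg.
have df j t : differentiable (flat j) t.
  by apply/derivable1_diffP; case: (flat_derive j t).
have dg u : D u -> differentiable g u by exact: smooth_differentiable sg.
elim: r k => [|r IH] k.
  move=> u /set_mem Du; apply: differentiable_continuous.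
  by apply: differentiable_comp; [exact: dg|exact: df].
split=> [u Du|i].
  by apply: differentiable_comp; [exact: dg|exact: df].
have := ndifferentiableM oD (ndifferentiableD oD (IH k.+2) (ndifferentiableM oD
  (ndifferentiable_cst r D (- k%:R)) (IH k.+1))) (smooth_derive i sg r).
apply: ndifferentiable_eq => // u Du.
have dcE : 'd (flat k \o g) u = 'd (flat k) (g u) \o 'd g u :> (_ -> R).
  by apply: diff_comp; [exact: dg|exact: df].
rewrite [RHS]deriveE; last by apply: differentiable_comp; [exact: dg|exact: df].
rewrite dcE /= -(deriveE _ (dg u Du)) diff1E; last exact: df.
have [_ E] := flat_derive k (g u).
by rewrite derive1E E mulNr /= /GRing.scale /= mulrC.
Qed.

(** The squared Euclidean distance, a polynomial; the norm of row vectors is the maximum norm, which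
    is not smooth. *)
Definition sqdist (a u : 'rV[R]_n) : R := \sum_j (u ord0 j - a ord0 j) ^+ 2.

Lemma smooth_sqdist D a : open D -> smooth_on D (sqdist a).
Proof.
move=> oD r; apply: ndifferentiable_sum => // j _.
have h : ndifferentiable r D (fun u => u ord0 j + (- a ord0 j)).
  by apply: ndifferentiableD => //; [exact: ndifferentiable_coord|exact: ndifferentiable_cst].
by apply: ndifferentiable_eq (ndifferentiableM oD h h).
Qed.

Definition ball_bump (e : R) (a u : 'rV[R]_n) : R :=
  flat 0 (e ^+ 2 - sqdist a u) / flat 0 (e ^+ 2).

Lemma smooth_ball_bump D e a : open D -> smooth_on D (ball_bump e a).
Proof.
move=> oD r; have h : smooth_on D (fun u => e ^+ 2 + (- 1) * sqdist a u).
  move=> q; apply: ndifferentiableD => //; first exact: ndifferentiable_cst.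
  by apply: ndifferentiableM => //; [exact: ndifferentiable_cst|exact: smooth_sqdist].
have := ndifferentiableM oD (ndifferentiable_flat r 0 oD h)
  (ndifferentiable_cst r D (flat 0 (e ^+ 2))^-1).
by apply: ndifferentiable_eq => // u _; rewrite /ball_bump /= mulN1r.
Qed.

Lemma ball_bump_center e a : 0 < e -> ball_bump e a a = 1.
Proof.
move=> e0; rewrite /ball_bump (_ : sqdist a a = 0) ?subr0 ?divff //.
  by rewrite /flat exprn_gt0 // gt_eqF // mulr_gt0 ?invr_gt0 ?exprn_gt0 ?expR_gt0.
by rewrite /sqdist big1 // => j _; rewrite subrr expr0n.
Qed.

(** Outside the ball of the maximum norm some coordinate differs by at least [e], so the squared
    Euclidean distance is at least [e ^+ 2] and [flat] receives a nonpositive argument. *)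
Lemma ball_bump_out e a u : 0 < e -> ~ closed_ball a e u -> ball_bump e a u = 0.
Proof.
move=> e0; rewrite closed_ballE // /closed_ball_ /= => /negP; rewrite -ltNge => h.
rewrite /ball_bump flat_le0 ?mul0r // subr_le0.
have [j hj] : exists j, e <= `|u ord0 j - a ord0 j|.
  apply: contrapT => nh; move: h; apply/negP; rewrite -leNgt.
  rewrite /Num.Def.normr /= mx_normrE; apply: bigmax_le => [|[i j] _]; first exact: ltW.
  rewrite !mxE distrC leNgt; apply/negP => hj; apply: nh; exists j.
  by rewrite (ord1 i) in hj; exact: ltW.
apply: (@le_trans _ _ (`|u ord0 j - a ord0 j| ^+ 2)).
  by rewrite lerXn2r ?nnegrE // ltW.
rewrite real_normK ?num_real // /sqdist (bigD1 j) //= lerDl.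
by apply: sumr_ge0 => i _; exact: sqr_ge0.
Qed.

End Bump.

(** * Exterior derivative in coordinates *)

Section FormCalculus.
Import Pilot.Defs.
Variables (R : realType) (m n : nat).
Implicit Types (D : set 'rV[R]_m) (F G : 'rV[R]_m -> ext R n).

Definition smooth_ext D F := forall I : {set 'I_n}, smooth_on D (fun u => F u I).

Lemma smooth_cst D (a : R) : smooth_on D (fun=> a).
Proof. by move=> r; exact: ndifferentiable_cst. Qed.

Lemma smoothD D (f g : 'rV[R]_m -> R) : open D -> smooth_on D f -> smooth_on D g ->
  smooth_on D (fun u => f u + g u).
Proof. by move=> oD sf sg r; apply: ndifferentiableD. Qed.

Lemma smoothM D (f g : 'rV[R]_m -> R) : open D -> smooth_on D f -> smooth_on D g ->
  smooth_on D (fun u => f u * g u).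
Proof. by move=> oD sf sg r; apply: ndifferentiableM. Qed.

Lemma smooth_sum D (I : Type) (s : seq I) (P : pred I) (f : I -> 'rV[R]_m -> R) :
  open D -> (forall i, P i -> smooth_on D (f i)) ->
  smooth_on D (fun u => \sum_(i <- s | P i) f i u).
Proof. by move=> oD sf r; apply: ndifferentiable_sum => // i Pi; exact: sf. Qed.

Lemma smooth_eq D (f g : 'rV[R]_m -> R) : open D -> (forall u, D u -> f u = g u) ->
  smooth_on D f -> smooth_on D g.
Proof. by move=> oD fg sf r; apply: ndifferentiable_eq fg _. Qed.

Lemma smooth_ext_eq D F G : open D -> (forall u, D u -> F u = G u) ->
  smooth_ext D F -> smooth_ext D G.
Proof.
by move=> oD FG sF I; apply: smooth_eq (sF I) => // u Du; rewrite FG.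
Qed.

Lemma smooth_ext_cst D (x : ext R n) : smooth_ext D (fun=> x).
Proof. by move=> I; exact: smooth_cst. Qed.

Lemma smooth_extD D F G : open D -> smooth_ext D F -> smooth_ext D G ->
  smooth_ext D (fun u => F u + G u).
Proof.
move=> oD sF sG I; apply: smooth_eq (smoothD oD (sF I) (sG I)) => // u _.
by rewrite ffunE.
Qed.

Lemma smooth_extZ D (f : 'rV[R]_m -> R) F : open D -> smooth_on D f ->
  smooth_ext D F -> smooth_ext D (fun u => f u *: F u).
Proof.
move=> oD sf sF I; apply: smooth_eq (smoothM oD sf (sF I)) => // u _.
by rewrite scaleE.
Qed.

Lemma smooth_ext_sum D (I : Type) (s : seq I) (P : pred I) (F : I -> 'rV[R]_m -> ext R n) :
  open D -> (forall i, P i -> smooth_ext D (F i)) ->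
  smooth_ext D (fun u => \sum_(i <- s | P i) F i u).
Proof.
move=> oD sF J.
apply: smooth_eq (smooth_sum (P := P) s (f := fun i u => F i u J) oD _) => // [u _|i Pi].
  by rewrite ext_sumE.
exact: sF.
Qed.

Lemma smooth_ext_wedge D F G : open D -> smooth_ext D F -> smooth_ext D G ->
  smooth_ext D (fun u => wedge (F u) (G u)).
Proof.
move=> oD sF sG K.
apply: smooth_eq (smooth_sum (P := fun I : {set 'I_n} => I \subset K) (index_enum _)
  (f := fun I u => (-1) ^+ inversions I (K :\: I)%SET * (F u I * G u (K :\: I)%SET)) oD _) => //.
  by move=> u _; rewrite ffunE.
by move=> I _; apply: smoothM => //; [exact: smooth_cst|exact: smoothM].
Qed.

Lemma smooth_pairing D F G : open D -> smooth_ext D F -> smooth_ext D G ->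
  smooth_on D (fun u => pairing (F u) (G u)).
Proof. by move=> oD sF sG; apply: smooth_sum => // I _; exact: smoothM. Qed.

Lemma smooth_ext_contract D F G : open D -> smooth_ext D F -> smooth_ext D G ->
  smooth_ext D (fun u => contract (F u) (G u)).
Proof.
move=> oD sF sG J; have := smooth_pairing oD sG
  (smooth_ext_wedge oD sF (smooth_ext_cst D (ebase J))).
by apply: smooth_eq => // u _; rewrite ffunE.
Qed.

Lemma smooth_extmap D (A : 'rV[R]_m -> 'M[R]_n) F : open D ->
  (forall i j, smooth_on D (fun u => A u i j)) -> smooth_ext D F ->
  smooth_ext D (fun u => extmap (A u) (F u)).
Proof.
move=> oD sA sF.
(* Constant arguments come first: [extmap] replaces each factor $e_i$ by a row of [A u], whose
   entries are smooth. Expanding [F u] in the basis then gives the general case. *)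
have s0 x : smooth_ext D (fun u => extmap (A u) x).
  elim/ext_ind: x => [|x y sx sy|a x sx|i x sx].
  - by apply: smooth_ext_eq (smooth_ext_cst D (ebase finset.set0)) => // u _; rewrite extmap1.
  - by apply: smooth_ext_eq (smooth_extD oD sx sy) => // u _; rewrite extmapD.
  - apply: smooth_ext_eq (smooth_extZ oD (smooth_cst D a) sx) => // u _.
    by rewrite extmapZ.
  have sr : smooth_ext D (fun u => arow (A u) i).
    apply: smooth_ext_sum => // j _; apply: smooth_extZ => //.
    exact: smooth_ext_cst.
  apply: smooth_ext_eq (smooth_ext_wedge oD sr sx) => // u _.
  by rewrite extmap_wedge_e.
have := smooth_ext_sum (P := xpredT) (index_enum _)
  (F := fun (I : {set 'I_n}) u => (F u I : R) *: extmap (A u) (ebase I)) oD.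
move=> /(_ (fun I _ => smooth_extZ oD (sF I) (s0 _))).
apply: smooth_ext_eq => // u _; rewrite [in RHS](ext_expand (F u)) extmap_sum.
by apply: eq_bigr => I _; rewrite extmapZ.
Qed.

Lemma smooth_pull D (A : 'rV[R]_m -> 'M[R]_n) F : open D ->
  (forall i j, smooth_on D (fun u => A u i j)) -> smooth_ext D F ->
  smooth_ext D (fun u => pull (A u) (F u)).
Proof.
move=> oD sA sF J; have := smooth_pairing oD sF
  (smooth_extmap oD sA (smooth_ext_cst D (ebase J))).
by apply: smooth_eq => // u _; rewrite ffunE.
Qed.

End FormCalculus.

Section ExteriorDerivative.
Import Pilot.Defs.
Variables (R : realType) (n : nat).
Implicit Types (D : set 'rV[R]_n) (f : 'rV[R]_n -> R) (F G : 'rV[R]_n -> ext R n).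

Definition ext_differentiable F u :=
  forall I : {set 'I_n}, differentiable (fun v => F v I : R) u.

Lemma smooth_ext_differentiable D F u :
  smooth_ext D F -> D u -> ext_differentiable F u.
Proof. by move=> sF Du I; exact: smooth_differentiable (sF I) Du. Qed.

Lemma pdiff_near i F G u : (\near u, F u = G u) -> pdiff i F u = pdiff i G u.
Proof.
move=> FG; apply/ffunP => I; rewrite !ffunE; apply: near_eq_derive.
by apply: filterS FG => v ->.
Qed.

Lemma pdiffD i F G u : ext_differentiable F u -> ext_differentiable G u ->
  pdiff i (fun v => F v + G v) u = pdiff i F u + pdiff i G u.
Proof.
move=> dF dG; apply/ffunP => I; rewrite !ffunE.
rewrite (_ : (fun _ => _) = (fun v => F v I : R) + (fun v => G v I : R)).
  by rewrite deriveD //; apply: diff_derivable; [exact: dF|exact: dG].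
by apply/funext => v; rewrite ffunE.
Qed.

Lemma pdiff_cst i x u : pdiff i (fun=> x) u = 0 :> ext R n.
Proof. by apply/ffunP => I; rewrite !ffunE derive_cst. Qed.

Lemma pdiffZ i f F u : differentiable f u -> ext_differentiable F u ->
  pdiff i (fun v => f v *: F v) u =
  'D_(e_ i) f u *: F u + f u *: pdiff i F u.
Proof.
move=> df dF; apply/ffunP => I; rewrite !ffunE.
rewrite (_ : (fun _ => _) = f * (fun v => F v I : R)).
  rewrite deriveM; [|exact: diff_derivable|apply: diff_derivable; exact: dF].
  by rewrite addrC [_ *: 'D__ f u]mulrC.
by apply/funext => v; rewrite scaleE.
Qed.

Lemma ext_differentiable_cst x u : ext_differentiable (fun=> x) u.
Proof. by move=> I; exact: differentiable_cst. Qed.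

Lemma ext_differentiableD F G u : ext_differentiable F u -> ext_differentiable G u ->
  ext_differentiable (fun v => F v + G v) u.
Proof.
move=> dF dG I; rewrite (_ : (fun _ => _) = (fun v => F v I : R) + (fun v => G v I : R)).
  by apply: differentiableD; [exact: dF|exact: dG].
by apply/funext => v; rewrite ffunE.
Qed.

Lemma ext_differentiableZ f F u : differentiable f u -> ext_differentiable F u ->
  ext_differentiable (fun v => f v *: F v) u.
Proof.
move=> df dF I; rewrite (_ : (fun _ => _) = f * (fun v => F v I : R)).
  by apply: differentiableM => //; exact: dF.
by apply/funext => v; rewrite scaleE.
Qed.

Lemma ext_differentiable_sum (T : Type) (s : seq T) (P : pred T)
    (F : T -> 'rV[R]_n -> ext R n) u :
  (forall t, P t -> ext_differentiable (F t) u) ->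
  ext_differentiable (fun v => \sum_(t <- s | P t) F t v) u.
Proof.
move=> dF; elim: s => [|t s IH].
  rewrite (_ : (fun _ => _) = fun=> 0); first exact: ext_differentiable_cst.
  by apply/funext => v; rewrite big_nil.
have [Pt|Pt] := boolP (P t).
  rewrite (_ : (fun _ => _) = fun v => F t v + \sum_(t <- s | P t) F t v).
    by apply: ext_differentiableD => //; exact: dF.
  by apply/funext => v; rewrite big_cons Pt.
rewrite (_ : (fun _ => _) = fun v => \sum_(t <- s | P t) F t v) //.
by apply/funext => v; rewrite big_cons (negbTE Pt).
Qed.

Lemma pdiff_sum i (T : Type) (s : seq T) (P : pred T) (F : T -> 'rV[R]_n -> ext R n) u :
  (forall t, P t -> ext_differentiable (F t) u) ->
  pdiff i (fun v => \sum_(t <- s | P t) F t v) u =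
    \sum_(t <- s | P t) pdiff i (F t) u.
Proof.
move=> dF; elim: s => [|t s IH].
  rewrite (_ : (fun _ => _) = fun=> 0) ?pdiff_cst ?big_nil //.
  by apply/funext => v; rewrite big_nil.
rewrite big_cons; case: ifPn => Pt.
  rewrite (_ : (fun _ => _) = fun v => F t v + \sum_(t <- s | P t) F t v).
    by rewrite pdiffD ?IH //; [exact: dF|exact: ext_differentiable_sum].
  by apply/funext => v; rewrite big_cons Pt.
rewrite (_ : (fun _ => _) = fun v => \sum_(t <- s | P t) F t v) //.
by apply/funext => v; rewrite big_cons (negbTE Pt).
Qed.

(** Linearity of [L] is stated as the expansion in the basis, which turns the claim into the
    derivative of a finite sum with constant vectors. *)
Lemma pdiff_linear i (L : ext R n -> ext R n) F u :
  (forall x, L x = \sum_J (x J : R) *: L (ebase J)) -> ext_differentiable F u ->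
  pdiff i (fun v => L (F v)) u = L (pdiff i F u).
Proof.
move=> hL dF.
rewrite (_ : (fun _ => _) = fun v => \sum_J (F v J : R) *: L (ebase J)).
  rewrite pdiff_sum => [|J _]; last first.
    by apply: ext_differentiableZ; [exact: dF|exact: ext_differentiable_cst].
  rewrite (hL (pdiff i F u)); apply: eq_bigr => J _.
  rewrite pdiffZ; [|exact: dF|exact: ext_differentiable_cst].
  by rewrite pdiff_cst scaler0 addr0 ffunE.
by apply/funext => v.
Qed.

Lemma ext_differentiable_linear (L : ext R n -> ext R n) F u :
  (forall x, L x = \sum_J (x J : R) *: L (ebase J)) -> ext_differentiable F u ->
  ext_differentiable (fun v => L (F v)) u.
Proof.
move=> hL dF.
rewrite (_ : (fun _ => _) = fun v => \sum_J (F v J : R) *: L (ebase J)).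
  apply: ext_differentiable_sum => J _.
  by apply: ext_differentiableZ; [exact: dF|exact: ext_differentiable_cst].
by apply/funext => v.
Qed.

Lemma wedge_expandr (x y : ext R n) : wedge x y = \sum_J (y J : R) *: wedge x (ebase J).
Proof.
have {1}-> := ext_expand y; rewrite wedge_sumr.
by apply: eq_bigr => J _; rewrite wedgeZr.
Qed.

Lemma wedge_expandl (x y : ext R n) : wedge x y = \sum_J (x J : R) *: wedge (ebase J) y.
Proof.
have {1}-> := ext_expand x; rewrite wedge_suml.
by apply: eq_bigr => J _; rewrite wedgeZl.
Qed.

Lemma pdiff_wedge i F G u : ext_differentiable F u -> ext_differentiable G u ->
  pdiff i (fun v => wedge (F v) (G v)) u =
  wedge (pdiff i F u) (G u) + wedge (F u) (pdiff i G u).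
Proof.
move=> dF dG.
rewrite (_ : (fun _ => _) = fun v => \sum_J (F v J : R) *: wedge (ebase J) (G v)).
  have dJ (J : {set 'I_n}) : ext_differentiable (fun v => wedge (ebase J) (G v)) u.
    exact: (ext_differentiable_linear (wedge_expandr _)).
  rewrite pdiff_sum => [|J _]; last by apply: ext_differentiableZ => //; exact: dF.
  rewrite (wedge_expandl (pdiff i F u)) (wedge_expandl (F u)) -big_split.
  apply: eq_bigr => J _; rewrite pdiffZ; [|exact: dF|exact: dJ].
  by rewrite (pdiff_linear _ (wedge_expandr _)) // ffunE.
by apply/funext => v; exact: wedge_expandl.
Qed.

(** The differential $df$, as a form of degree 1 in the dual basis. *)
Definition grad f u : ext R n := \sum_(i < n) 'D_(e_ i) f u *: ebase [set i]%SET.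

Definition dext F u : ext R n :=
  \sum_(i < n) wedge (ebase [set i]%SET) (pdiff i F u).

Lemma dext_near F G u : (\near u, F u = G u) -> dext F u = dext G u.
Proof.
by move=> FG; apply: eq_bigr => i _; rewrite (pdiff_near i FG).
Qed.

Lemma dext_cst x u : dext (fun=> x) u = 0.
Proof. by apply: big1 => i _; rewrite pdiff_cst wedge0r. Qed.

Lemma dextD F G u : ext_differentiable F u -> ext_differentiable G u ->
  dext (fun v => F v + G v) u = dext F u + dext G u.
Proof.
by move=> dF dG; rewrite -big_split; apply: eq_bigr => i _; rewrite pdiffD // wedgeDr.
Qed.

Lemma dext_sum (T : Type) (s : seq T) (P : pred T) (F : T -> 'rV[R]_n -> ext R n) u :
  (forall t, P t -> ext_differentiable (F t) u) ->
  dext (fun v => \sum_(t <- s | P t) F t v) u = \sum_(t <- s | P t) dext (F t) u.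
Proof.
move=> dF; rewrite /dext exchange_big /=; apply: eq_bigr => i _.
by rewrite pdiff_sum // wedge_sumr.
Qed.

Lemma dextZ f F u : differentiable f u -> ext_differentiable F u ->
  dext (fun v => f v *: F v) u = wedge (grad f u) (F u) + f u *: dext F u.
Proof.
move=> df dF; rewrite wedge_suml scaler_sumr -big_split; apply: eq_bigr => i _.
by rewrite pdiffZ // wedgeDr !wedgeZr wedgeZl.
Qed.

Lemma homog_e i : homog 1 (ebase [set i]%SET : ext R n).
Proof. by have := @homog_ebase R n [set i]%SET; rewrite cards1. Qed.

Lemma homog_grad f u : homog 1 (grad f u).
Proof. by apply: homog_sum => i _; apply: homogZ; exact: homog_e. Qed.

(** The minus sign comes from moving $dx^i$ past the 1-form [F u]. Together with $d(dT_i)=0$ this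
    treats products of differentials factor by factor. *)
Lemma dext_wedge F G u : homog 1 (F u) -> ext_differentiable F u ->
  ext_differentiable G u ->
  dext (fun v => wedge (F v) (G v)) u =
  wedge (dext F u) (G u) - wedge (F u) (dext G u).
Proof.
move=> hF dF dG; rewrite wedge_suml wedge_sumr -sumrB; apply: eq_bigr => i _.
rewrite pdiff_wedge // wedgeDr !wedgeA; congr (_ + _).
by rewrite (wedge_anticomm (@homog_e _) hF) wedgeNl.
Qed.

Lemma smooth_grad D f : open D -> smooth_on D f -> smooth_ext D (grad f).
Proof.
move=> oD sf; apply: smooth_ext_sum => // i _; apply: smooth_extZ => //.
  exact: smooth_derive.
exact: smooth_ext_cst.
Qed.

(** The second derivatives are symmetric in the two indices and $dx^i\wedge dx^k$ is antisymmetric,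
    so exchanging the sums shows that $d(df)$ is its own opposite. *)
Lemma dext_grad D f u : open D -> smooth_on D f -> D u -> dext (grad f) u = 0.
Proof.
move=> oD sf Du.
have E : dext (grad f) u = \sum_(i < n) \sum_(k < n)
    'D_(e_ i) ('D_(e_ k) f) u *: wedge (ebase [set i]%SET) (ebase [set k]%SET).
  apply: eq_bigr => i _; rewrite /grad pdiff_sum => [|k _]; last first.
    apply: ext_differentiableZ; last exact: ext_differentiable_cst.
    exact: smooth_differentiable (smooth_derive k sf) Du.
  rewrite wedge_sumr; apply: eq_bigr => k _; rewrite pdiffZ.
  - by rewrite pdiff_cst scaler0 addr0 wedgeZr.
  - exact: smooth_differentiable (smooth_derive k sf) Du.
  - exact: ext_differentiable_cst.
have : dext (grad f) u = - dext (grad f) u.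
  rewrite {1}E exchange_big E -sumrN; apply: eq_bigr => i _.
  rewrite -sumrN; apply: eq_bigr => k _.
  have sw := smooth_swap k i oD sf Du.
  have wa := wedge_anticomm (@homog_e k) (@homog_e i).
  by rewrite sw wa; exact: scalerN.
move/eqP; rewrite -subr_eq0 opprK -mulr2n -scaler_nat scaler_eq0 pnatr_eq0 /=.
by move/eqP.
Qed.

Lemma jacobianE (T : 'rV[R]_n -> 'rV[R]_n) u i j : differentiable T u ->
  'J T u i j = 'D_(e_ i) (fun v => T v ord0 j) u.
Proof.
move=> dT; rewrite /jacobian mxE -(deriveE _ dT) derive_mx ?mxE //.
exact: diff_derivable.
Qed.

(** * Exterior derivative and pullback by a smooth map *)

Section Naturality.
Variables (D D' : set 'rV[R]_n) (T : 'rV[R]_n -> 'rV[R]_n).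
Hypotheses (oD : open D) (oD' : open D') (TD : forall u, D u -> D' (T u)).
Hypothesis sT : forall j, smooth_on D (fun u => T u ord0 j).

Lemma smooth_row_differentiable u : D u -> differentiable T u.
Proof.
by move=> Du; apply: differentiable_row => j; exact: smooth_differentiable (sT j) Du.
Qed.

Lemma smooth_jacobian i j : smooth_on D (fun u => 'J T u i j).
Proof.
apply: smooth_eq (smooth_derive i (sT j)) => // u Du.
by rewrite jacobianE //; exact: smooth_row_differentiable.
Qed.

Lemma pull_jacobian_e u i w : D u -> pull ('J T u) (wedge (ebase [set i]%SET) w) =
  wedge (grad (fun v => T v ord0 i) u) (pull ('J T u) w).
Proof.
move=> Du; rewrite pull_wedge_e; congr wedge; apply: eq_bigr => j _.
by rewrite jacobianE //; exact: smooth_row_differentiable.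
Qed.

(* A pulled back constant form is a combination of products of differentials [dT_i]. *)
Lemma dext_pull_cst x u : D u -> dext (fun v => pull ('J T v) x) u = 0.
Proof.
have sp y : smooth_ext D (fun v => pull ('J T v) y).
  by apply: smooth_pull => //; [exact: smooth_jacobian|exact: smooth_ext_cst].
elim/ext_ind: x u => [|x y hx hy|a x hx|i x hx] u Du.
- rewrite (_ : (fun _ => _) = fun=> ebase finset.set0) ?dext_cst //.
  by apply/funext => v; rewrite pull1.
- rewrite (_ : (fun _ => _) = fun v => pull ('J T v) x + pull ('J T v) y).
    by rewrite dextD ?hx ?hy ?addr0 //; exact: smooth_ext_differentiable Du.
  by apply/funext => v; rewrite pullD.
- rewrite (_ : (fun _ => _) = fun v => a *: pull ('J T v) x).
    rewrite dextZ ?hx //; last exact: smooth_ext_differentiable Du.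
    by rewrite scaler0 addr0 /grad big1 ?wedge0l // => j _; rewrite derive_cst scale0r.
  by apply/funext => v; rewrite pullZ.
have sg := smooth_grad oD (sT i).
rewrite (dext_near (G := fun v =>
  wedge (grad (fun v => T v ord0 i) v) (pull ('J T v) x))).
  rewrite dext_wedge ?hx //; last 3 first.
  - exact: homog_grad.
  - exact: smooth_ext_differentiable sg Du.
  - exact: smooth_ext_differentiable (sp x) Du.
  by rewrite (dext_grad oD (sT i) Du) wedge0l wedge0r subr0.
by apply: open_near oD Du _ => v Dv; rewrite pull_jacobian_e.
Qed.

Lemma grad_comp f u : D u -> differentiable f (T u) ->
  grad (f \o T) u = \sum_(j < n) 'D_(e_ j) f (T u) *: grad (fun v => T v ord0 j) u.
Proof.
move=> Du df; rewrite /grad; under [RHS]eq_bigr do rewrite scaler_sumr.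
rewrite exchange_big; apply: eq_bigr => i _ /=.
rewrite derive_comp_row //; last exact: smooth_row_differentiable.
by rewrite scaler_suml; apply: eq_bigr => j _; rewrite scalerA.
Qed.

(** Write the pulled-back form as $\sum_I(F_I\circ T)\,T^*dx^I$. The forms $T^*dx^I$ are closed, so
    only the differentials of the coefficients remain, and the chain rule expresses them through the
    $dT_j=T^*dx^j$. *)
Lemma dext_pull F u : smooth_ext D' F -> D u ->
  dext (fun v => pull ('J T v) (F (T v))) u = pull ('J T u) (dext F (T u)).
Proof.
move=> sF Du.
have sp y : smooth_ext D (fun v => pull ('J T v) y).
  by apply: smooth_pull => //; [exact: smooth_jacobian|exact: smooth_ext_cst].
have dFT I : differentiable (fun v => F (T v) I : R) u.
  exact: smooth_differentiable (smooth_comp oD oD' TD sT (sF I)) Du.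
have dF I : differentiable (fun v => F v I : R) (T u).
  by apply: smooth_differentiable (sF I) _; exact: TD.
rewrite (_ : (fun _ => _) = fun v => \sum_I (F (T v) I : R) *: pull ('J T v) (ebase I)).
  pose dFI (I : {set 'I_n}) (j : 'I_n) : R := 'D_(e_ j) (fun v => F v I : R) (T u).
  transitivity (\sum_(I : {set 'I_n}) \sum_(j < n) dFI I j *:
      wedge (grad (fun v => T v ord0 j) u) (pull ('J T u) (ebase I))); last first.
    rewrite exchange_big [RHS]pull_sum; apply: eq_bigr => j _.
    rewrite (pull_jacobian_e _ _ Du) [pdiff j F (T u)]ext_expand pull_sum wedge_sumr.
    by apply: eq_bigr => I _; rewrite pullZ wedgeZr ffunE.
  rewrite dext_sum => [|I _]; last first.
    apply: ext_differentiableZ; [exact: dFT|exact: smooth_ext_differentiable (sp _) Du].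
  apply: eq_bigr => I _.
  rewrite dextZ; [|exact: dFT|exact: smooth_ext_differentiable (sp _) Du].
  rewrite (dext_pull_cst _ Du) scaler0 addr0.
  rewrite [grad _ u](grad_comp (f := fun v => F v I : R) Du (dF I)) wedge_suml.
  by apply: eq_bigr => j _; rewrite wedgeZl.
apply/funext => v; rewrite {1}(ext_expand (F (T v))) pull_sum.
by apply: eq_bigr => I _; rewrite pullZ.
Qed.

End Naturality.
End ExteriorDerivative.

(** * Charts *)

Section Charts.
Import Pilot.Defs.
Variables (R : realType) (n : nat) (M : manifold R n).
Implicit Types (c : chart R n M) (p q : M) (u v : 'rV[R]_n).

Lemma cparamK_dom c p : atlas c -> cdom c p -> cparam c (ccoord c p) = p.
Proof. by move=> ac cp; apply: (ccoordK (atlas_chart ac)); exact: mem_set. Qed.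

Lemma cimg_ccoord c p : cdom c p -> cimg c (ccoord c p).
Proof. by move=> cp; exists p. Qed.

Lemma cdom_cparam c u : atlas c -> cimg c u -> cdom c (cparam c u).
Proof. by move=> ac [p cp <-]; rewrite cparamK_dom. Qed.

Lemma ccoordK_img c u : atlas c -> cimg c u -> ccoord c (cparam c u) = u.
Proof. by move=> ac [p cp <-]; rewrite cparamK_dom. Qed.

(** The domain of [transition c c'] in the coordinates of [c]. Written with a preimage instead of
    the image used in [smooth_compatible], it is open by continuity of [cparam c]. *)
Definition overlap c c' := cimg c `&` cparam c @^-1` cdom c'.

Lemma open_cimg_preimage c (U : set M) : atlas c -> open U ->
  open (cimg c `&` cparam c @^-1` U).
Proof.
move=> ac oU; have hc := atlas_chart ac.
rewrite openE => u [cu Uu]; apply: filterI.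
  exact: open_nbhs_nbhs (conj (cimg_open hc) cu).
apply: (cparam_continuous hc (mem_set cu)).
exact: open_nbhs_nbhs.
Qed.

Lemma open_overlap c c' : atlas c -> atlas c' -> open (overlap c c').
Proof.
by move=> ac ac'; apply: open_cimg_preimage => //; exact: cdom_open (atlas_chart ac').
Qed.

Lemma overlap_ccoord c c' p : atlas c -> cdom c p -> cdom c' p ->
  overlap c c' (ccoord c p).
Proof.
move=> ac cp c'p; split; first exact: cimg_ccoord.
by rewrite /preimage /= cparamK_dom.
Qed.

Lemma overlapP c c' u : atlas c -> overlap c c' u ->
  exists p, [/\ cdom c p, cdom c' p & u = ccoord c p].
Proof.
move=> ac [cu c'u]; exists (cparam c u); split=> //; first exact: cdom_cparam.
by rewrite ccoordK_img.
Qed.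

Lemma transition_ccoord c c' p : atlas c -> cdom c p ->
  transition c c' (ccoord c p) = ccoord c' p.
Proof. by move=> ac cp; rewrite /transition /= cparamK_dom. Qed.

Lemma overlap_transition c c' u : atlas c -> atlas c' -> overlap c c' u ->
  overlap c' c (transition c c' u).
Proof.
move=> ac ac' /(overlapP ac)[p [cp c'p ->]]; rewrite transition_ccoord //.
exact: overlap_ccoord.
Qed.

Lemma smooth_transition c c' j : atlas c -> atlas c' ->
  smooth_on (overlap c c') (fun u => transition c c' u ord0 j).
Proof.
move=> ac ac' r; apply: ndifferentiable_sub (atlas_compatible ac ac' j r).
by move=> u /(overlapP ac)[p [cp c'p ->]]; exists p.
Qed.

Lemma transition_differentiable c c' u : atlas c -> atlas c' -> overlap c c' u ->
  differentiable (transition c c') u.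
Proof.
move=> ac ac'; apply: smooth_row_differentiable => j; exact: smooth_transition.
Qed.

(** Acting on rows from the right, it carries components in [c] to components in [c'], so changes of
    chart compose in reading order. *)
Definition jac c c' p : 'M[R]_n := 'J (transition c c') (ccoord c p).

(** This is the chain rule. The transition from [c1] to [c3] is known to factor through [c2] only
    where all three charts are defined, so it is replaced by the composite near the point. *)
Lemma jac_comp c1 c2 c3 p : atlas c1 -> atlas c2 -> atlas c3 ->
  cdom c1 p -> cdom c2 p -> cdom c3 p -> jac c1 c3 p = jac c1 c2 p *m jac c2 c3 p.
Proof.
move=> a1 a2 a3 d1 d2 d3; have ov a b := @overlap_ccoord a b p.
have td a b (aa : atlas a) (ab : atlas b) (da : cdom a p) (db : cdom b p) :=
  transition_differentiable aa ab (ov _ _ aa da db).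
have [t12 t23 t13] := And3 (td _ _ a1 a2 d1 d2) (td _ _ a2 a3 d2 d3) (td _ _ a1 a3 d1 d3).
rewrite -(transition_ccoord c2 a1 d1) in t23.
apply/matrixP => i k; rewrite [RHS]mxE [LHS](jacobianE _ _ t13).
rewrite (near_eq_derive (g := (fun v => transition c2 c3 v ord0 k) \o transition c1 c2)).
  rewrite derive_comp_row //; last first.
    by apply: (@differentiable_comp _ _ _ _ (transition c2 c3) (fun v => v ord0 k)) => //;
      exact: differentiable_coord0.
  apply: eq_bigr => j _; rewrite mulrC; congr (_ * _).
    exact: (esym (jacobianE i j t12)).
  rewrite /jac -(transition_ccoord c2 a1 d1).
  exact: (esym (jacobianE j k t23)).
have oD := openI (open_overlap a1 a2) (open_overlap a1 a3).
apply: (open_near oD); first by split; exact: ov.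
move=> v [/(overlapP a1)[q [q1 q2 ->]] _] /=.
by rewrite !transition_ccoord.
Qed.

Lemma jac_id c p : atlas c -> cdom c p -> jac c c p = 1%:M.
Proof.
move=> ac cp; have ov := overlap_ccoord ac cp cp.
apply/matrixP => i j.
rewrite [LHS](jacobianE _ _ (transition_differentiable ac ac ov)).
rewrite (near_eq_derive (g := fun v => v ord0 j)); last first.
  apply: (open_near (open_overlap ac ac) ov) => v /(overlapP ac)[q [q1 _ ->]].
  by rewrite transition_ccoord.
by rewrite derive_coord mxE eq_sym.
Qed.

Lemma smooth_jac c c' i j : atlas c -> atlas c' ->
  smooth_on (overlap c c') (fun u => 'J (transition c c') u i j).
Proof.
move=> ac ac'; apply: smooth_jacobian; first exact: open_overlap.
by move=> k; exact: smooth_transition.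
Qed.

Hint Resolve chart_at_atlas chart_at_dom : core.

Lemma mv_coord_ccoord c X p : atlas c -> cdom c p ->
  mv_coord c X (ccoord c p) = extmap (jac (chart_at p) c p) (X p).
Proof. by move=> ac cp; rewrite /mv_coord /= cparamK_dom. Qed.

Lemma form_coord_ccoord c w p : atlas c -> cdom c p ->
  form_coord c w (ccoord c p) = pull (jac c (chart_at p) p) (w p).
Proof. by move=> ac cp; rewrite /form_coord /= cparamK_dom. Qed.

Lemma mv_coord_chart_at X p : mv_coord (chart_at p) X (ccoord (chart_at p) p) = X p.
Proof. by rewrite mv_coord_ccoord // jac_id // extmap_id. Qed.

Lemma form_coord_chart_at w p :
  form_coord (chart_at p) w (ccoord (chart_at p) p) = w p.
Proof. by rewrite form_coord_ccoord // jac_id // pull_id. Qed.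

Lemma mv_coord_change c c' X p : atlas c -> atlas c' -> cdom c p -> cdom c' p ->
  mv_coord c' X (ccoord c' p) = extmap (jac c c' p) (mv_coord c X (ccoord c p)).
Proof.
move=> ac ac' cp c'p.
rewrite (mv_coord_ccoord X ac cp).
rewrite (mv_coord_ccoord X ac' c'p).
rewrite [RHS]extmap_comp.
by rewrite (jac_comp (chart_at_atlas p) ac ac' (chart_at_dom p) cp c'p).
Qed.

Lemma mv_coordK c X p : atlas c -> cdom c p ->
  extmap (jac c (chart_at p) p) (mv_coord c X (ccoord c p)) = X p.
Proof.
move=> ac cp; rewrite -(mv_coord_change X ac (chart_at_atlas p) cp (chart_at_dom p)).
exact: mv_coord_chart_at.
Qed.

Lemma form_coord_change c c' w p : atlas c -> atlas c' -> cdom c p -> cdom c' p ->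
  form_coord c w (ccoord c p) = pull (jac c c' p) (form_coord c' w (ccoord c' p)).
Proof.
move=> ac ac' cp c'p; rewrite (form_coord_ccoord w ac cp).
rewrite (form_coord_ccoord w ac' c'p) [RHS]pull_comp.
by rewrite (jac_comp ac ac' (chart_at_atlas p) cp c'p (chart_at_dom p)).
Qed.

Lemma pairing_coord c w X p : atlas c -> cdom c p ->
  pairing (form_coord c w (ccoord c p)) (mv_coord c X (ccoord c p)) =
  pairing (w p) (X p).
Proof.
by move=> ac cp; rewrite (form_coord_ccoord w ac cp) pairing_pull (mv_coordK X ac cp).
Qed.

Lemma form_coord_contract c w Y p : atlas c -> cdom c p ->
  form_coord c (fcontract Y w) (ccoord c p) =
  contract (mv_coord c Y (ccoord c p)) (form_coord c w (ccoord c p)).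
Proof.
move=> ac cp; apply: pairing_inj => z; rewrite pairing_contract.
rewrite (form_coord_ccoord w ac cp) (form_coord_ccoord (fcontract Y w) ac cp).
by rewrite !pairing_pull pairing_contract extmap_wedge (mv_coordK Y ac cp).
Qed.

Lemma mv_coord_wedge c X Y u :
  mv_coord c (fwedge X Y) u = wedge (mv_coord c X u) (mv_coord c Y u).
Proof. by rewrite /mv_coord /= extmap_wedge. Qed.

Lemma mv_coord_fscale c f X u :
  mv_coord c (fscale f X) u = f (cparam c u) *: mv_coord c X u.
Proof. by rewrite /mv_coord /= extmapZ. Qed.

Lemma mv_coordD c X Y u :
  mv_coord c (fun p => X p + Y p) u = mv_coord c X u + mv_coord c Y u.
Proof. by rewrite /mv_coord /= extmapD. Qed.

Lemma mv_coord_of_fun c (f : M -> R) u :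
  mv_coord c (of_fun f) u = f (cparam c u) *: ebase finset.set0.
Proof. by rewrite /mv_coord /= extmapZ extmap1. Qed.

Lemma form_coord_pull c (w : ext_field M) u : form_coord c w u =
  pull ('J (transition c (chart_at (cparam c u))) u) (w (cparam c u)).
Proof. by []. Qed.

Lemma form_coord_fscale c f w u :
  form_coord c (fscale f w) u = f (cparam c u) *: form_coord c w u.
Proof. by rewrite !form_coord_pull pullZ. Qed.

Lemma form_coordD c X Y u :
  form_coord c (fun p => X p + Y p) u = form_coord c X u + form_coord c Y u.
Proof. by rewrite !form_coord_pull pullD. Qed.

End Charts.

(** * Smooth fields on a manifold *)

Section SmoothFields.
Import Pilot.Defs.
Variables (R : realType) (n : nat) (M : manifold R n).
Implicit Types (c : chart R n M) (p q : M) (u v : 'rV[R]_n) (X Y w : ext_field M).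
Implicit Types (f g : M -> R).

Definition smooth_form w := forall c, atlas c -> smooth_ext (cimg c) (form_coord c w).

(** It transfers results on fields to functions, in particular extension by zero. *)
Lemma smooth_fun_of_fun f : smooth_fun f <-> multivector_field (of_fun f).
Proof.
split=> sf c ac; have oc := cimg_open (atlas_chart ac).
  move=> I; apply: smooth_eq (smoothM oc (sf c ac)
    (smooth_cst (cimg c) (ebase finset.set0 I : R))) => //.
  by move=> u _; rewrite mv_coord_of_fun scaleE.
apply: smooth_eq (sf c ac finset.set0) => // u _.
by rewrite mv_coord_of_fun scaleE ebaseE eqxx mulr1.
Qed.

Lemma multivector_fieldD X Y : multivector_field X -> multivector_field Y ->
  multivector_field (fun p => X p + Y p).
Proof.
move=> sX sY c ac; have oc := cimg_open (atlas_chart ac).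
apply: smooth_ext_eq (smooth_extD oc (sX c ac) (sY c ac)) => // u _.
by rewrite mv_coordD.
Qed.

Lemma multivector_field_fscale f X : smooth_fun f -> multivector_field X ->
  multivector_field (fscale f X).
Proof.
move=> sf sX c ac; have oc := cimg_open (atlas_chart ac).
apply: smooth_ext_eq (smooth_extZ oc (sf c ac) (sX c ac)) => // u _.
by rewrite mv_coord_fscale.
Qed.

Lemma multivector_field_wedge X Y : multivector_field X -> multivector_field Y ->
  multivector_field (fwedge X Y).
Proof.
move=> sX sY c ac; have oc := cimg_open (atlas_chart ac).
apply: smooth_ext_eq (smooth_ext_wedge oc (sX c ac) (sY c ac)) => // u _.
by rewrite mv_coord_wedge.
Qed.

Lemma multivector_field0 : multivector_field (fun _ : M => 0 : ext R n).
Proof.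
move=> c ac; have oc := cimg_open (atlas_chart ac).
apply: smooth_ext_eq (smooth_ext_cst (cimg c) 0) => // u _.
by rewrite /mv_coord /= extmap0.
Qed.

Lemma smooth_funM f g : smooth_fun f -> smooth_fun g -> smooth_fun (fun p => f p * g p).
Proof.
move=> sf sg c ac; have oc := cimg_open (atlas_chart ac).
exact: smoothM oc (sf c ac) (sg c ac).
Qed.

Lemma smooth_funD f g : smooth_fun f -> smooth_fun g -> smooth_fun (fun p => f p + g p).
Proof.
move=> sf sg c ac; have oc := cimg_open (atlas_chart ac).
exact: smoothD oc (sf c ac) (sg c ac).
Qed.

Lemma smooth_fun_cst (a : R) : smooth_fun (fun _ : M => a).
Proof. by move=> c ac; exact: smooth_cst. Qed.

Lemma smooth_feval w X : smooth_form w -> multivector_field X -> smooth_fun (feval w X).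
Proof.
move=> sw sX c ac; have oc := cimg_open (atlas_chart ac).
apply: smooth_eq (smooth_pairing oc (sw c ac) (sX c ac)) => // u cu.
have cp := cdom_cparam ac cu; rewrite /= /feval -(pairing_coord w X ac cp).
by rewrite (ccoordK_img ac cu).
Qed.

Lemma smooth_form_contract Y w : multivector_field Y -> smooth_form w ->
  smooth_form (fcontract Y w).
Proof.
move=> sY sw c ac; have oc := cimg_open (atlas_chart ac).
apply: smooth_ext_eq (smooth_ext_contract oc (sY c ac) (sw c ac)) => // u cu.
have := form_coord_contract w Y ac (cdom_cparam ac cu).
by rewrite (ccoordK_img ac cu).
Qed.

Lemma ext_dE w p :
  ext_d w p = dext (form_coord (chart_at p) w) (ccoord (chart_at p) p).
Proof. by []. Qed.

(** [ext_d w] is computed at each point in that point's own chart. Naturality under the transition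
    map allows a single chart [c] for all its points, where smoothness can be seen. *)
Lemma form_coord_ext_d c w p : atlas c -> smooth_form w -> cdom c p ->
  form_coord c (ext_d w) (ccoord c p) = dext (form_coord c w) (ccoord c p).
Proof.
move=> ac sw cp; set c' := chart_at p.
have ac' : atlas c' by exact: chart_at_atlas. have c'p : cdom c' p by exact: chart_at_dom.
rewrite (form_coord_ccoord _ ac cp) ext_dE -/c'.
have oD := open_overlap ac ac'; have oD' := cimg_open (atlas_chart ac').
have ov := overlap_ccoord ac cp c'p.
have TD u : overlap c c' u -> cimg c' (transition c c' u).
  by move=> /(overlap_transition ac ac') [].
have sT j := @smooth_transition _ _ _ _ _ j ac ac'.
have := dext_pull oD oD' TD sT (sw c' ac') ov.
rewrite (transition_ccoord c' ac cp) => E; rewrite [LHS](esym E).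
apply: dext_near; apply: (open_near oD ov) => v /(overlapP ac)[q [q1 q2 ->]].
rewrite (transition_ccoord c' ac q1).
exact: esym (form_coord_change w ac ac' q1 q2).
Qed.

Lemma pairing_ext_d c w X p : atlas c -> smooth_form w -> cdom c p ->
  pairing (ext_d w p) (X p) =
  pairing (dext (form_coord c w) (ccoord c p)) (mv_coord c X (ccoord c p)).
Proof.
move=> ac sw cp; rewrite -(form_coord_ext_d ac sw cp).
exact: esym (pairing_coord (ext_d w) X ac cp).
Qed.

Lemma smooth_dext (D : set 'rV[R]_n) (F : 'rV[R]_n -> ext R n) : open D ->
  smooth_ext D F -> smooth_ext D (dext F).
Proof.
move=> oD sF; apply: smooth_ext_sum => // i _; apply: smooth_ext_wedge => //.
  exact: smooth_ext_cst.
move=> I; apply: smooth_eq (smooth_derive i (sF I)) => // u _.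
by rewrite ffunE.
Qed.

Lemma smooth_feval_ext_d w X : smooth_form w -> multivector_field X ->
  smooth_fun (feval (ext_d w) X).
Proof.
move=> sw sX c ac; have oc := cimg_open (atlas_chart ac).
apply: smooth_eq (smooth_pairing oc (smooth_dext oc (sw c ac)) (sX c ac)) => // u cu.
have := pairing_ext_d X ac sw (cdom_cparam ac cu).
by rewrite (ccoordK_img ac cu) => E; exact: (esym E).
Qed.

Definition dfun f p : ext R n := grad (f \o cparam (chart_at p)) (ccoord (chart_at p) p).

Lemma homog_dfun f p : homog 1 (dfun f p).
Proof. exact: homog_grad. Qed.

Lemma ext_d_fscale f w p : smooth_fun f -> smooth_form w ->
  ext_d (fscale f w) p = wedge (dfun f p) (w p) + f p *: ext_d w p.
Proof.
move=> sf sw; rewrite !ext_dE; set c := chart_at p.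
have ac : atlas c by exact: chart_at_atlas. have cp : cdom c p by exact: chart_at_dom.
have cu := cimg_ccoord cp.
rewrite (_ : form_coord c (fscale f w) =
    fun v => (f \o cparam c) v *: form_coord c w v); last first.
  by apply/funext => v; rewrite form_coord_fscale.
rewrite dextZ.
- by rewrite form_coord_chart_at /= (cparamK_dom ac cp).
- exact: smooth_differentiable (sf c ac) cu.
- exact: smooth_ext_differentiable (sw c ac) cu.
Qed.

Lemma ext_dD w w' p : smooth_form w -> smooth_form w' ->
  ext_d (fun q => w q + w' q) p = ext_d w p + ext_d w' p.
Proof.
move=> sw sw'; rewrite !ext_dE; set c := chart_at p.
have ac : atlas c by exact: chart_at_atlas. have cp : cdom c p by exact: chart_at_dom.
have cu := cimg_ccoord cp.
rewrite (_ : form_coord c _ = fun v => form_coord c w v + form_coord c w' v).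
  rewrite dextD //; first exact: smooth_ext_differentiable (sw c ac) cu.
  exact: smooth_ext_differentiable (sw' c ac) cu.
by apply/funext => v; rewrite form_coordD.
Qed.

(** Since [pull] preserves degrees, a component of wrong degree is the zero function on all of
    $\mathbb{R}^n$, hence so is its derivative. *)
Lemma homog_ext_d (k : int) w p : (forall q, homog k (w q)) -> homog (1 + k) (ext_d w p).
Proof.
move=> hw; apply: homog_sum => i _; apply: homog_wedge; first exact: homog_e.
move=> I; rewrite ffunE => DI; apply/eqP; apply: contraNT DI => Ik.
rewrite (_ : (fun _ => _) = fun=> 0); first by rewrite derive_cst.
apply/funext => v; apply/eqP; apply: contraNT Ik => h; apply/eqP; move: h.
by rewrite form_coord_pull; apply: homog_pull.
Qed.

(** The domain of [c] and the complement of [K] form an open cover: on the first, the components in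
    another chart follow from those in [c] by a change of chart; on the second, they vanish. *)
Lemma glue_multivector_field c (K : set M) X : atlas c -> closed K -> K `<=` cdom c ->
  (forall p, ~ K p -> X p = 0) -> smooth_ext (cimg c) (mv_coord c X) ->
  multivector_field X.
Proof.
move=> ac cK Kc X0 sX c' ac' I r; apply: ndifferentiable_local => u c'u.
have c'p := cdom_cparam ac' c'u; set p := cparam c' u in c'p.
have [cp|cp] := pselect (cdom c p).
  have ou : overlap c' c u by split.
  have oD := open_overlap ac' ac; exists (overlap c' c) => //.
  have TD v : overlap c' c v -> overlap c c' (transition c' c v).
    exact: overlap_transition.
  have sT j := @smooth_transition _ _ _ _ _ j ac' ac.
  have sXo : smooth_ext (overlap c c')
      (fun v => extmap ('J (transition c c') v) (mv_coord c X v)).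
    apply: smooth_extmap; first exact: open_overlap.
      by move=> i j; exact: smooth_jac.
    by move=> J q; apply: ndifferentiable_sub (sX J q) => v [].
  apply: ndifferentiable_eq oD _ (smooth_comp oD (open_overlap ac ac') TD sT (sXo I) r).
  move=> v /(overlapP ac')[q [q1 q2 ->]].
  rewrite /comp (transition_ccoord c ac' q1).
  exact: (congr1 (fun x : ext R n => x I) (esym (mv_coord_change X ac ac' q2 q1))).
have Kp : ~ K p by move=> /Kc.
have oD : open (cimg c' `&` cparam c' @^-1` ~` K).
  by apply: open_cimg_preimage => //; exact: closed_openC.
exists (cimg c' `&` cparam c' @^-1` ~` K); first by split.
apply: ndifferentiable_eq (ndifferentiable_cst r _ 0) => // v [_ Kv].
by rewrite /mv_coord /= (X0 _ Kv) extmap0 ffunE.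
Qed.

(** [phi] is prescribed at [p] alone and need not be 1 near [p]: linearity over functions lets the
    factor be removed by evaluating at [p]. *)
Record is_bump c p (K : set M) (phi : M -> R) : Prop := IsBump {
  bump_closed : closed K;
  bump_dom : K `<=` cdom c;
  bump_at : phi p = 1;
  bump_supp : forall q, ~ K q -> phi q = 0;
  bump_smooth : smooth_fun phi }.

Lemma bump_exists c p : atlas c -> cdom c p -> exists K phi, is_bump c p K phi.
Proof.
move=> ac cp; have hc := atlas_chart ac; set a := ccoord c p.
have [e /= e0 eD] := (nbhs_ballP _ _).1
  (open_nbhs_nbhs (conj (cimg_open hc) (cimg_ccoord cp))).
(* Half the radius, so that the closed ball stays inside the open ball contained in the image of the
   chart. Its image in [M] is compact, hence closed because [M] is Hausdorff. *)
have e20 : 0 < e / 2 by rewrite divr_gt0.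
pose B := closed_ball a (e / 2).
have BD : B `<=` cimg c.
  apply: subset_trans eD; apply: closed_ball_subset => //.
  by rewrite ltr_pdivrMr // ltr_pMr // ltr1n.
pose K := cparam c @` B.
have cB : compact B.
  apply: bounded_closed_compact; last exact: closed_ball_closed.
  exists (`|a| + e / 2); split; first exact: num_real.
  move=> m /ltW hm x; rewrite /B closed_ballE // /closed_ball_ /= => ax.
  apply: le_trans hm; rewrite -[x](subKr a) (le_trans (ler_normB _ _)) //.
  by rewrite lerD2l.
have KD : K `<=` cdom c by move=> _ [u Bu <-]; apply: (cdom_cparam ac); exact: BD.
have cK : closed K.
  apply: compact_closed; first exact: manifold_hausdorff.
  apply: continuous_compact cB; apply: continuous_in_subspaceT => u uB.
  by apply: (cparam_continuous hc); apply/mem_set/BD; exact: set_mem.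
pose phi q : R := if pselect (cdom c q) then ball_bump (e / 2) a (ccoord c q) else 0.
have phiE q : cdom c q -> phi q = ball_bump (e / 2) a (ccoord c q).
  by rewrite /phi; case: pselect.
have supp q : ~ K q -> phi q = 0.
  rewrite /phi; case: pselect => // cq Kq; apply: ball_bump_out => // Bq; apply: Kq.
  by exists (ccoord c q) => //; exact: cparamK_dom.
exists K, phi; split=> //; first by rewrite (phiE _ cp) ball_bump_center.
apply/smooth_fun_of_fun; apply: (glue_multivector_field ac cK KD) => [q /supp Kq|].
  by rewrite /of_fun Kq scale0r.
have oc := cimg_open hc.
apply: smooth_ext_eq (smooth_extZ oc (smooth_ball_bump (e / 2) a oc)
  (smooth_ext_cst (cimg c) (ebase finset.set0))) => // u cu.
rewrite mv_coord_of_fun (phiE _ (cdom_cparam ac cu)).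
by rewrite (ccoordK_img ac cu).
Qed.

Lemma bump_multivector_field c p K phi X : atlas c -> is_bump c p K phi ->
  smooth_ext (cimg c) (mv_coord c X) -> multivector_field (fscale phi X).
Proof.
move=> ac [cK KD _ supp sphi] sX.
apply: (glue_multivector_field ac cK KD) => [q /supp E|].
  by rewrite /fscale E scale0r.
have oc := cimg_open (atlas_chart ac).
apply: smooth_ext_eq (smooth_extZ oc (sphi c ac) sX) => // u _.
by rewrite mv_coord_fscale.
Qed.

(* The field with constant components [x] in the chart [c]; its values outside of
   [cdom c] are junk. *)
Definition chart_lift c (x : ext R n) : ext_field M :=
  fun q => extmap (jac c (chart_at q) q) x.

Lemma mv_coord_chart_lift c x q : atlas c -> cdom c q ->
  mv_coord c (chart_lift c x) (ccoord c q) = x.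
Proof.
move=> ac cq; rewrite (mv_coord_ccoord _ ac cq) [LHS]extmap_comp.
rewrite -(jac_comp ac (chart_at_atlas q) ac cq (chart_at_dom q) cq).
by rewrite (jac_id ac cq) extmap_id.
Qed.

Lemma smooth_chart_lift c x : atlas c -> smooth_ext (cimg c) (mv_coord c (chart_lift c x)).
Proof.
move=> ac; have oc := cimg_open (atlas_chart ac).
apply: smooth_ext_eq (smooth_ext_cst (cimg c) x) => // u cu.
have := mv_coord_chart_lift x ac (cdom_cparam ac cu).
by rewrite (ccoordK_img ac cu).
Qed.

Lemma chart_lift_mv_coord c X q : atlas c -> cdom c q ->
  chart_lift c (mv_coord c X (ccoord c q)) q = X q.
Proof. by move=> ac cq; exact: mv_coordK. Qed.

Lemma chart_lift_chart_at p x : chart_lift (chart_at p) x p = x.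
Proof. by rewrite /chart_lift jac_id ?extmap_id //; [exact: chart_at_atlas|exact: chart_at_dom]. Qed.

Lemma bump_smooth_fun c p K phi (f : M -> R) : atlas c -> is_bump c p K phi ->
  smooth_on (cimg c) (f \o cparam c) -> smooth_fun (fun q => phi q * f q).
Proof.
move=> ac bphi sf; apply/smooth_fun_of_fun.
rewrite (_ : of_fun _ = fscale phi (of_fun f)); last first.
  by apply/funext => q; rewrite /fscale /of_fun scalerA.
have oc := cimg_open (atlas_chart ac).
apply: (bump_multivector_field ac bphi).
apply: smooth_ext_eq (smooth_extZ oc sf
  (smooth_ext_cst (cimg c) (ebase finset.set0))) => // u _.
by rewrite mv_coord_of_fun.
Qed.

End SmoothFields.

(** * Tensoriality *)

Section Tensoriality.
Import Pilot.Defs.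
Variables (R : realType) (n : nat) (M : manifold R n).
Implicit Types (c : chart R n M) (p q : M) (X Y Z w : ext_field M).
Implicit Types (f g : M -> R) (k l : int).

Lemma kvector_fieldD k X Y : kvector_field k X -> kvector_field k Y ->
  kvector_field k (fun p => X p + Y p).
Proof.
move=> [sX hX] [sY hY]; split; first exact: multivector_fieldD.
by move=> p; exact: homogD.
Qed.

Lemma kvector_field_fscale k f X : smooth_fun f -> kvector_field k X ->
  kvector_field k (fscale f X).
Proof.
move=> sf [sX hX]; split; first exact: multivector_field_fscale.
by move=> p; exact: homogZ.
Qed.

Lemma kvector_field0 k : kvector_field k (fun _ : M => 0 : ext R n).
Proof. by split; [exact: multivector_field0|move=> p; exact: homog0]. Qed.

Lemma kvector_field_wedge k l X Y : kvector_field k X -> kvector_field l Y ->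
  kvector_field (k + l) (fwedge X Y).
Proof.
move=> [sX hX] [sY hY]; split; first exact: multivector_field_wedge.
by move=> p; exact: homog_wedge.
Qed.

Lemma homog_ebase0 (a : R) : homog 0 (a *: ebase finset.set0 : ext R n).
Proof. by apply: homogZ; have := @homog_ebase R n finset.set0; rewrite cards0. Qed.

Lemma kvector_field_of_fun f : smooth_fun f -> kvector_field 0 (of_fun f).
Proof.
by move=> sf; split; [exact/smooth_fun_of_fun|move=> p; exact: homog_ebase0].
Qed.

Lemma bump_lift c p K phi (I : {set 'I_n}) : atlas c -> is_bump c p K phi ->
  kvector_field (#|I|)%:Z (fscale phi (chart_lift c (ebase I))).
Proof.
move=> ac bphi; split; first exact: (bump_multivector_field ac bphi (smooth_chart_lift _ ac)).
by move=> q; apply: homogZ; apply: homog_extmap; exact: homog_ebase.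
Qed.

Lemma smooth_fun_bump_mv_coord c p K phi Y (I : {set 'I_n}) : atlas c -> is_bump c p K phi ->
  multivector_field Y ->
  smooth_fun (fun q => phi q * (mv_coord c Y (ccoord c q) I : R)).
Proof.
move=> ac bphi sY; apply: (bump_smooth_fun ac bphi).
apply: smooth_eq (sY c ac I); first exact: cimg_open (atlas_chart ac).
by move=> u cu; rewrite /comp (ccoordK_img ac cu).
Qed.

Section Operator.
Variables (m : int) (Phi : ext_field M -> ext_field M) (p : M).
Hypothesis PhiD : forall Y Z, kvector_field m Y -> kvector_field m Z ->
  Phi (fun q => Y q + Z q) p = Phi Y p + Phi Z p.
Hypothesis PhiZ : forall f Y, smooth_fun f -> kvector_field m Y ->
  Phi (fscale f Y) p = f p *: Phi Y p.

Lemma operator0 : Phi (fun=> 0) p = 0.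
Proof.
have := PhiZ (smooth_fun_cst (M := M) 0) (kvector_field0 m).
rewrite scale0r (_ : fscale _ _ = fun=> 0) //.
by apply/funext => q; rewrite /fscale scaler0.
Qed.

Lemma operator_sum (I : Type) (s : seq I) (P : pred I) (g : I -> M -> R)
    (Z : I -> ext_field M) :
  (forall i, P i -> smooth_fun (g i)) -> (forall i, P i -> kvector_field m (Z i)) ->
  Phi (fun q => \sum_(i <- s | P i) g i q *: Z i q) p =
    \sum_(i <- s | P i) g i p *: Phi (Z i) p.
Proof.
move=> sg kZ.
(* The induction also carries the fact that the partial sum is a field of degree [m], without which
   [PhiD] does not apply to it. *)
suff: Phi (fun q => \sum_(i <- s | P i) g i q *: Z i q) p =
    \sum_(i <- s | P i) g i p *: Phi (Z i) p /\
    kvector_field m (fun q => \sum_(i <- s | P i) g i q *: Z i q) by case.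
elim: s => [|i s [IH kS]].
  rewrite (_ : (fun _ => _) = fun=> 0); last by apply/funext => q; rewrite big_nil.
  by rewrite operator0 big_nil; split=> //; exact: kvector_field0.
rewrite big_cons; case: ifPn => Pi.
  rewrite (_ : (fun _ => _) =
    fun q => fscale (g i) (Z i) q + \sum_(i <- s | P i) g i q *: Z i q).
    have kgZ := kvector_field_fscale (sg i Pi) (kZ i Pi).
    split; last exact: kvector_fieldD.
    by rewrite (PhiD kgZ kS) IH (PhiZ (sg i Pi) (kZ i Pi)).
  by apply/funext => q; rewrite big_cons Pi.
rewrite (_ : (fun _ => _) = fun q => \sum_(i <- s | P i) g i q *: Z i q) //.
by apply/funext => q; rewrite big_cons (negbTE Pi).
Qed.

Lemma tensor_expand c K phi Y : atlas c -> is_bump c p K phi -> kvector_field m Y ->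
  Phi Y p = \sum_(I : {set 'I_n} | (#|I|)%:Z == m)
    (mv_coord c Y (ccoord c p) I : R) *: Phi (fscale phi (chart_lift c (ebase I))) p.
Proof.
(* Multiplying by [phi] twice makes both factors of [Y^I e_I] global fields. *)
move=> ac bphi kY; have [_ KD phip supp sphi] := bphi.
have sphi2 := smooth_funM sphi sphi.
transitivity (Phi (fscale (fun q => phi q * phi q) Y) p).
  by rewrite (PhiZ sphi2 kY) phip mulr1 scale1r.
pose g (I : {set 'I_n}) q : R := phi q * (mv_coord c Y (ccoord c q) I : R).
rewrite (_ : fscale _ Y = fun q => \sum_(I : {set 'I_n} | (#|I|)%:Z == m)
    g I q *: fscale phi (chart_lift c (ebase I)) q).
  rewrite operator_sum => [|I _|I /eqP <-]; last 2 first.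
  - by apply: smooth_fun_bump_mv_coord ac bphi _; case: kY.
  - exact: bump_lift bphi.
  by apply: eq_bigr => I _; rewrite /g phip mul1r.
apply/funext => q; rewrite /fscale /g.
have [cq|cq] := pselect (cdom c q); last first.
  rewrite supp ?mul0r ?scale0r; last by move=> /KD.
  by rewrite big1 // => I _; rewrite mul0r scale0r.
set y := mv_coord c Y (ccoord c q).
have hy : homog m y by rewrite /y (mv_coord_ccoord Y ac cq); apply: homog_extmap; case: kY.
transitivity ((phi q * phi q) *: chart_lift c y q); first by rewrite /y (chart_lift_mv_coord Y ac cq).
rewrite /chart_lift [y in LHS]ext_expand extmap_sum scaler_sumr [RHS]big_mkcond.
apply: eq_bigr => I _; rewrite extmapZ !scalerA; case: ifPn => [_|Im].
  by congr (_ *: _); exact: mulrAC.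
have -> : y I = 0 by apply/eqP; apply: contraNT Im => /hy ->.
by rewrite mulr0 scale0r.
Qed.

(** In [tensor_expand] the field enters only through its components at [p], which in the chart
    [chart_at p] are its value there. *)
Lemma tensor_pointwise Y Z : kvector_field m Y -> kvector_field m Z -> Y p = Z p ->
  Phi Y p = Phi Z p.
Proof.
move=> kY kZ YZ; have ac := chart_at_atlas p; have cp := chart_at_dom p.
have [K [phi bphi]] := bump_exists ac cp.
rewrite (tensor_expand ac bphi kY) (tensor_expand ac bphi kZ).
by rewrite !mv_coord_chart_at YZ.
Qed.

End Operator.
End Tensoriality.

(** * Schouten bracket with a function *)

Section Schouten.
Import Pilot.Defs.
Variables (R : realType) (n : nat) (M : manifold R n).
Variable br : ext_field M -> ext_field M -> ext_field M.
Hypothesis hbr : is_schouten br.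
Implicit Types (c : chart R n M) (p q : M) (X Y Z w : ext_field M).
Implicit Types (f g : M -> R) (k l : int).

Lemma schoutenDr P Q S : multivector_field P -> multivector_field Q ->
  multivector_field S -> br P (fun p => Q p + S p) = (fun p => br P Q p + br P S p).
Proof.
move=> sP sQ sS; have := schouten_linearr hbr 1 sP sQ sS.
rewrite (_ : (fun p => 1 *: Q p + S p) = (fun p => Q p + S p)); last first.
  by apply/funext => p; rewrite scale1r.
by move=> ->; apply/funext => p; rewrite scale1r.
Qed.

(** In the Leibniz rule for $g\wedge Q$ the term $[f,g]\wedge Q$ vanishes and the sign is 1, as $g$
    has degree 0. *)
Lemma schouten_fun_fscale f g Q p : smooth_fun f -> smooth_fun g ->
  multivector_field Q ->
  br (of_fun f) (fscale g Q) p = g p *: br (of_fun f) Q p.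
Proof.
move=> sf sg sQ; have kf := kvector_field_of_fun sf; have kg := kvector_field_of_fun sg.
have fw (S : ext_field M) : fwedge (of_fun g) S = fscale g S.
  by apply/funext => q; rewrite /fwedge wedgeZl wedge1l.
have := schouten_leibniz hbr kf kg sQ; rewrite fw => ->.
by rewrite fw (schouten_fun hbr sf sg) mulr0 expr0z scale1r /fwedge wedge0l add0r.
Qed.

Lemma lie_mv_of_fun X f p : smooth_fun f ->
  lie_mv X (of_fun f) p = pairing (dfun f p) (X p) *: ebase finset.set0.
Proof.
move=> sf; rewrite /lie_mv pairingC pairing_sumr scaler_suml.
set c := chart_at p; have ac := chart_at_atlas p; have cp := chart_at_dom p.
apply: eq_bigr => i _.
have -> : contract (ebase [set i]%SET) (of_fun f p) = 0.
  by rewrite contractZr contract_e1 inE scaler0.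
rewrite wedge0r subr0 (_ : mv_coord c (of_fun f) =
  fun u => (f \o cparam c) u *: ebase finset.set0).
  rewrite pdiffZ; last 2 first.
  - exact: smooth_differentiable (sf c ac) (cimg_ccoord cp).
  - exact: ext_differentiable_cst.
  by rewrite pdiff_cst scaler0 addr0 scalerA pairingZr pairing_ebase mulrC.
by apply/funext => u; rewrite mv_coord_of_fun.
Qed.

Lemma schouten_fun_vector f X p : smooth_fun f -> kvector_field 1 X ->
  br (of_fun f) X p = - (pairing (dfun f p) (X p) *: ebase finset.set0).
Proof.
move=> sf kX; have kf := kvector_field_of_fun sf.
rewrite (schouten_antisym hbr kf kX) (schouten_lie hbr kX kf.1).
by rewrite (lie_mv_of_fun X p sf) subrr mulr0 expr0z scaleN1r.
Qed.

(** A product of global vector fields, accessible to the Leibniz rule. In the chart it differs from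
    the cut-off of $e_I$ by powers of [phi], which equal 1 at the point of interest. *)
Fixpoint frame_product c (phi : M -> R) (s : seq 'I_n) : ext_field M :=
  if s is i :: s' then
    fwedge (fscale phi (chart_lift c (ebase [set i]%SET))) (frame_product c phi s')
  else of_fun (fun=> 1).

Lemma kvector_field_frame_product c p K phi s : atlas c -> is_bump c p K phi ->
  kvector_field (size s)%:Z (frame_product c phi s).
Proof.
move=> ac bphi; elim: s => [|i s IH] /=.
  by apply: kvector_field_of_fun; exact: smooth_fun_cst.
rewrite -add1n PoszD; apply: kvector_field_wedge => //.
by have := bump_lift [set i]%SET ac bphi; rewrite cards1.
Qed.

Lemma bump_lift_at p K phi x : is_bump (chart_at p) p K phi ->
  fscale phi (chart_lift (chart_at p) x) p = x.
Proof. by move=> [_ _ phip _ _]; rewrite /fscale phip scale1r chart_lift_chart_at. Qed.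

Lemma frame_product_at p K phi s : is_bump (chart_at p) p K phi ->
  frame_product (chart_at p) phi s p =
    \big[wedge/ebase finset.set0]_(i <- s) ebase [set i]%SET.
Proof.
move=> bphi; elim: s => [|i s IH]; first by rewrite big_nil /= /of_fun scale1r.
by rewrite big_cons /= /fwedge IH (bump_lift_at _ bphi).
Qed.

Lemma frame_product_enum p K phi (I : {set 'I_n}) : is_bump (chart_at p) p K phi ->
  frame_product (chart_at p) phi (enum I) p = ebase I.
Proof.
move=> bphi; rewrite (frame_product_at _ bphi) -[RHS]extmap_id extmap_ebase.
by apply: eq_bigr => i _; rewrite -extmap_e extmap_id.
Qed.

Lemma contract_homog1_wedge (a x : ext R n) i : homog 1 a ->
  contract a (wedge (ebase [set i]%SET) x) =
  (a [set i]%SET : R) *: x - wedge (ebase [set i]%SET) (contract a x).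
Proof.
move=> ha; have aE : a = \sum_(j < n) (a [set j]%SET : R) *: ebase [set j]%SET.
  apply/ffunP => I; rewrite ext_sumE.
  have [/eqP/cards1P[j ->]|I1] := eqVneq #|I| 1%N.
    rewrite (bigD1 j) //= scaleE ebaseE eqxx mulr1 big1 ?addr0 // => k kj.
    by rewrite scaleE ebaseE (inj_eq set1_inj) eq_sym (negbTE kj) mulr0.
  rewrite (homogE ha I1) big1 // => j _; rewrite scaleE ebaseE.
  case: eqVneq => [IE|]; last by rewrite mulr0.
  by rewrite IE cards1 in I1.
rewrite {1 3}aE !contract_suml wedge_sumr.
transitivity (\sum_(j < n) ((a [set j]%SET * (j == i)%:R : R) *: x -
   wedge (ebase [set i]%SET) (contract ((a [set j]%SET : R) *: ebase [set j]%SET) x))).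
  apply: eq_bigr => j _; rewrite !contractZl contract_wedge scalerBr scalerA.
  by rewrite wedgeZr.
rewrite sumrB -scaler_suml; congr (_ *: _ - _).
by rewrite (bigD1 i) //= eqxx mulr1 big1 ?addr0 // => j /negbTE ->; rewrite mulr0.
Qed.

(** Both $[f,\cdot]$ and $-i_{df}$ kill the constant 1, agree on vector fields, and pick up the same
    sign when they pass a vector factor. *)
Lemma schouten_fun_frame_product f p K phi s : smooth_fun f ->
  is_bump (chart_at p) p K phi ->
  br (of_fun f) (frame_product (chart_at p) phi s) p =
    - contract (dfun f p) (frame_product (chart_at p) phi s p).
Proof.
move=> sf bphi; have ac := chart_at_atlas p.
have kf := kvector_field_of_fun sf.
elim: s => [|i s IH].
  rewrite [LHS](_ : _ = 0); last first.
    by rewrite /frame_product (schouten_fun hbr sf (smooth_fun_cst (M := M) 1)).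
  rewrite /= /of_fun scale1r (homog_lt0 _ (homog_contract (@homog_dfun _ _ _ f p)
    (@homog_ebase R n finset.set0))) ?oppr0 //.
  by rewrite cards0.
have ke : kvector_field 1 (fscale phi (chart_lift (chart_at p) (ebase [set i]%SET))).
  by have := bump_lift [set i]%SET ac bphi; rewrite cards1.
have ks := kvector_field_frame_product s ac bphi.
have := schouten_leibniz hbr kf ke ks.1 => /= ->.
have fwE (X Y : ext_field M) : fwedge X Y p = wedge (X p) (Y p) by [].
rewrite !fwE (schouten_fun_vector p sf ke) IH !(bump_lift_at _ bphi).
rewrite (contract_homog1_wedge _ _ (@homog_dfun _ _ _ f p)).
rewrite sub0r mulN1r exprN1 invrN1 wedgeNl wedgeZl wedge1l pairing_ebase wedgeNr.
by rewrite scaleN1r opprK opprB addrC.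
Qed.

Lemma schouten_fun_kvector k f X p : smooth_fun f -> kvector_field k X ->
  br (of_fun f) X p = - contract (dfun f p) (X p).
Proof.
(* By tensoriality the frame field [phi e_I] may be replaced by a product of vector
   fields [phi e_i], on which the Leibniz rule applies. *)
move=> sf kX; have ac := chart_at_atlas p; have cp := chart_at_dom p.
have [K [phi bphi]] := bump_exists ac cp.
have sF := (kvector_field_of_fun sf).1.
have BD m Y Z : kvector_field m Y -> kvector_field m Z ->
    br (of_fun f) (fun q => Y q + Z q) p = br (of_fun f) Y p + br (of_fun f) Z p.
  by move=> [sY _] [sZ _]; rewrite schoutenDr.
have BZ m g Y : smooth_fun g -> kvector_field m Y ->
    br (of_fun f) (fscale g Y) p = g p *: br (of_fun f) Y p.
  by move=> sg [sY _]; exact: schouten_fun_fscale.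
rewrite (tensor_expand (BD k) (BZ k) ac bphi kX) mv_coord_chart_at.
transitivity (\sum_(I : {set 'I_n} | (#|I|)%:Z == k)
    (X p I : R) *: - contract (dfun f p) (ebase I)).
  apply: eq_bigr => I _; congr (_ *: _).
  have kW := kvector_field_frame_product (enum I) ac bphi.
  rewrite -cardE in kW.
  rewrite (tensor_pointwise (BD _) (BZ _) (bump_lift I ac bphi) kW).
    by rewrite (schouten_fun_frame_product _ sf bphi) (frame_product_enum _ bphi).
  by rewrite (bump_lift_at _ bphi) (frame_product_enum _ bphi).
rewrite [X p in RHS]ext_expand contract_sumr -sumrN [LHS]big_mkcond.
apply: eq_bigr => I _; rewrite contractZr scalerN; case: ifPn => // Ik.
have -> : X p I = 0 by apply/eqP; apply: contraNT Ik => /kX.2 ->.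
by rewrite scale0r oppr0.
Qed.

(** The exponent is kept as antisymmetry yields it, with $0-1$ coming from the degree of [f]; it is
    simplified only in [sign_identity]. *)
Lemma schouten_kvector_fun k f X p : smooth_fun f -> kvector_field k X ->
  br X (of_fun f) p =
    ((-1) ^ ((k - 1) * (0 - 1)) : R) *: contract (dfun f p) (X p).
Proof.
move=> sf kX; rewrite (schouten_antisym hbr kX (kvector_field_of_fun sf)).
by rewrite (schouten_fun_kvector p sf kX) scaleNr scalerN opprK.
Qed.

End Schouten.

(** * The form nabla_X w *)

(* [a = k - 1] is the degree of [i_df X] and [b = l - k + 1] that of [Y]; the left-hand
   side is the sign of [<d (i_Y w), X>] in [nabla_X w (Y)], the right-hand side that of
   [w ([X,f] /\ Y)] once [Y] is moved in front of [i_df X]. *)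
Lemma sign_identity (R : realType) (a b : nat) (k l : int) :
  k = a%:Z + 1 -> l = a%:Z + b%:Z ->
  (-1) ^ ((k - 1) * (l - 1)) * - (-1) ^ k =
  (-1) ^ ((k - 1) * (0 - 1)) * (-1) ^+ (a * b) :> R.
Proof.
move=> -> ->.
have n0 : (-1 : R) != 0 by rewrite oppr_eq0 oner_eq0.
have -> : (a%:Z + 1 - 1) * (a%:Z + b%:Z - 1) = (a * a)%:Z + (a * b)%:Z - a%:Z by lia.
have -> : (a%:Z + 1 - 1) * (0 - 1) = - a%:Z by lia.
rewrite !expfzDr // -!exprnP expr1 mulrN1 opprK.
(* $a^2$ and $a$ have the same parity, so on the left only the sign of $ab$ survives next to that of
   $-a$. *)
have -> : (-1 : R) ^+ (a * a) = (-1) ^+ a.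
  by rewrite -[LHS]signr_odd oddM andbb signr_odd.
have sV : (-1 : R) ^ (- a%:Z) = (-1) ^+ a by rewrite -exprz_inv invrN1 -exprnP.
by rewrite sV -[LHS]mulrA sign2 mulr1.
Qed.

Section NablaForm.
Import Pilot.Defs.
Variables (R : realType) (n : nat) (M : manifold R n).
Variables br nabla : ext_field M -> ext_field M -> ext_field M.
Hypotheses (hbr : is_schouten br) (hnabla : higher_connection br nabla).
Variables (k l : int) (w X : ext_field M).
Hypotheses (w_form : diff_form l w) (X_kvector : kvector_field k X) (k_gt0 : 0 < k).
Hypothesis b_ge0 : 0 <= l - k + 1.
Implicit Types (c : chart R n M) (p q : M) (Y Z : ext_field M) (f : M -> R).
Let b := l - k + 1.

Let sw : smooth_form w.
Proof. exact: w_form.1. Qed.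

Let sX : multivector_field X.
Proof. exact: X_kvector.1. Qed.

(* The term [d i_X i_Y w] of [L_X i_Y w] vanishes for reasons of degree. *)
Definition nabla_scalar Y : M -> R := fun p =>
  ((-1) ^ ((k - 1) * (l - 1)) * - (-1) ^ k) * feval (ext_d (fcontract Y w)) X p
  - feval w (nabla X Y) p.

Lemma homog0E (x : ext R n) : homog 0 x -> x = (x finset.set0 : R) *: ebase finset.set0.
Proof.
move=> hx; apply/ffunP => I; rewrite scaleE ebaseE.
have [->|I0] := eqVneq I finset.set0; first by rewrite mulr1.
by rewrite mulr0 (homogE hx) // cards_eq0.
Qed.

Lemma homog_fcontract Y p : kvector_field b Y -> homog (k - 1) (fcontract Y w p).
Proof.
move=> [_ hY]; have -> : k - 1 = l - b by rewrite /b; lia.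
exact: homog_contract (w_form.2 p).
Qed.

Lemma nabla_form_valueE Y : kvector_field b Y ->
  nabla_form_value nabla k l X w Y = of_fun (nabla_scalar Y).
Proof.
move=> kY; apply/funext => p; rewrite /nabla_form_value /lie_form.
have -> : fcontract X (fcontract Y w) = fun=> 0.
  apply/funext => q.
  by apply: (homog_lt0 _ (homog_contract (X_kvector.2 q) (@homog_fcontract Y q kY))); lia.
have -> : ext_d (fun _ : M => 0 : ext R n) p = 0.
  rewrite ext_dE (_ : form_coord _ _ = fun=> 0) ?dext_cst //.
  by apply/funext => u; rewrite form_coord_pull pull0.
(* $d(i_Yw)$ has degree $k$, like $X$. The contraction is therefore a scalar, given by its component
   at the empty set, where [contract] reduces to [pairing]. *)
have h0 : homog 0 (fcontract X (ext_d (fcontract Y w)) p).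
  have hd : homog (1 + (k - 1)) (ext_d (fcontract Y w) p).
    by apply: homog_ext_d => q; exact: homog_fcontract.
  have := homog_contract (X_kvector.2 p) hd.
  by rewrite (_ : 1 + (k - 1) - k = 0) //; lia.
rewrite (homog0E h0) ffunE wedge1r.
by rewrite sub0r -scaleNr !scalerA /of_fun -scalerBl.
Qed.

Lemma nabla_scalarD Y Z p : kvector_field b Y -> kvector_field b Z ->
  nabla_scalar (fun q => Y q + Z q) p = nabla_scalar Y p + nabla_scalar Z p.
Proof.
move=> [sY _] [sZ _]; rewrite /nabla_scalar /feval (nabla_addr hnabla sX sY sZ).
rewrite (_ : fcontract _ w = fun q => fcontract Y w q + fcontract Z w q); last first.
  by apply/funext => q; exact: contractDl.
rewrite (ext_dD p (smooth_form_contract sY sw) (smooth_form_contract sZ sw)).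
by rewrite pairingDl pairingDr mulrDr opprD addrACA.
Qed.

Lemma nabla_scalar_fscale f Y p : smooth_fun f -> kvector_field b Y ->
  nabla_scalar (fscale f Y) p = f p * nabla_scalar Y p.
Proof.
move=> sf kY; have [sY hY] := kY; rewrite /nabla_scalar /feval.
rewrite (nabla_leibniz hnabla sX sf sY).
rewrite (_ : fcontract _ w = fscale f (fcontract Y w)); last first.
  by apply/funext => q; exact: contractZl.
rewrite (ext_d_fscale p sf (smooth_form_contract sY sw)).
rewrite pairingDl pairingZl pairingDr pairingZr.
have fwE : fwedge (br X (of_fun f)) Y p = wedge (br X (of_fun f) p) (Y p) by [].
rewrite fwE.
rewrite (schouten_kvector_fun hbr p sf X_kvector) wedgeZl pairingZr.
(* [wedge_comm] takes natural degrees; they are available because $k>0$ and $l-k+1\ge0$. *)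
have [a aE] : exists a : nat, k = a%:Z + 1 by exists `|k - 1|%N; lia.
have [b' bE] : exists b' : nat, b = b'%:Z by exists `|b|%N; rewrite /b; lia.
have lE : l = a%:Z + b'%:Z by rewrite -bE /b; lia.
have hY' : homog b'%:Z (Y p) by rewrite -bE.
have hC : homog a%:Z (contract (dfun f p) (X p)).
  have -> : a%:Z = k - 1 by rewrite aE; lia.
  apply: homog_contract (X_kvector.2 p); exact: homog_dfun.
(* Once $Y$ stands in front, $w(Y\wedge i_{df}X)=\langle i_Yw,i_{df}X\rangle=\langle df\wedge
   i_Yw,X\rangle$, the same pairing as in the term produced by $d(f\,i_Yw)$. *)
rewrite (wedge_comm hC hY') pairingZr -pairing_contract -/(fcontract Y w p).
rewrite [pairing (fcontract Y w p) _]pairingC [pairing (contract _ _) _]pairing_contract.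
rewrite [pairing (X p) _]pairingC (sign_identity R aE lE).
have E (s t x y z g : R) :
  s * t * (x + g * y) - (s * (t * x) + g * z) = g * (s * t * y - z) by ring.
exact: E.
Qed.

Lemma smooth_nabla_scalar Y : kvector_field b Y -> smooth_fun (nabla_scalar Y).
Proof.
move=> [sY _].
have sn : multivector_field (nabla X Y) by exact: (@nabla_mv _ _ _ _ _ hnabla _ _ sX sY).
have := smooth_funD (smooth_funM
  (smooth_fun_cst (M := M) ((-1) ^ ((k - 1) * (l - 1)) * - (-1) ^ k))
  (smooth_feval_ext_d (smooth_form_contract sY sw) sX))
  (smooth_funM (smooth_fun_cst (M := M) (-1)) (smooth_feval sw sn)).
rewrite (_ : (fun p => _ + _) = nabla_scalar Y) //.
by apply/funext => p; rewrite /nabla_scalar mulN1r.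
Qed.

Lemma nabla_scalar_expand c p K phi Y : atlas c -> is_bump c p K phi ->
  kvector_field b Y -> nabla_scalar Y p = \sum_(I : {set 'I_n} | (#|I|)%:Z == b)
    mv_coord c Y (ccoord c p) I * nabla_scalar (fscale phi (chart_lift c (ebase I))) p.
Proof.
move=> ac bphi kY.
(* [tensor_expand] is about operators with values in fields; the scalar is embedded by [of_fun] and
   recovered as the component at the empty set. *)
have ND Y' Z : kvector_field b Y' -> kvector_field b Z ->
    of_fun (nabla_scalar (fun q => Y' q + Z q)) p =
    of_fun (nabla_scalar Y') p + of_fun (nabla_scalar Z) p.
  by move=> kY' kZ; rewrite /of_fun nabla_scalarD // scalerDl.
have NZ f Y' : smooth_fun f -> kvector_field b Y' ->
    of_fun (nabla_scalar (fscale f Y')) p = f p *: of_fun (nabla_scalar Y') p.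
  by move=> sf kY'; rewrite /of_fun nabla_scalar_fscale // scalerA.
have := tensor_expand (Phi := fun Y => of_fun (nabla_scalar Y)) ND NZ ac bphi kY.
move/ffunP/(_ finset.set0); rewrite ext_sumE /of_fun scaleE ebaseE eqxx mulr1 => ->.
by apply: eq_bigr => I _; rewrite !scaleE ebaseE eqxx mulr1.
Qed.

Lemma chart_bump_exists p :
  exists phi, exists K, is_bump (chart_at p) p K phi.
Proof.
have [K [phi h]] := bump_exists (chart_at_atlas p) (chart_at_dom p).
by exists phi, K.
Qed.

(** One bump function chosen for every point, with no regularity in [p]. By tensoriality the values
    at [p] computed with it do not depend on the choice. *)
Definition chart_bump p : M -> R := sval (cid (chart_bump_exists p)).

Lemma chart_bumpP p : exists K, is_bump (chart_at p) p K (chart_bump p).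
Proof. exact: svalP (cid (chart_bump_exists p)). Qed.

Definition nabla_form : ext_field M := fun p => [ffun I : {set 'I_n} =>
  if (#|I|)%:Z == b then
    nabla_scalar (fscale (chart_bump p) (chart_lift (chart_at p) (ebase I))) p
  else 0].

Lemma homog_nabla_form p : homog b (nabla_form p).
Proof.
by move=> I; rewrite ffunE; have [//|_] := eqVneq (#|I|)%:Z b; move/eqP.
Qed.

Lemma feval_nabla_form Y p : kvector_field b Y ->
  feval nabla_form Y p = nabla_scalar Y p.
Proof.
move=> kY; have [K bphi] := chart_bumpP p.
rewrite (nabla_scalar_expand (chart_at_atlas p) bphi kY) mv_coord_chart_at.
rewrite /feval (pairing_homog _ (@homog_nabla_form p)).
by apply: eq_bigr => I Ib; rewrite ffunE Ib mulrC.
Qed.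

Lemma nabla_form_diff_form : diff_form b nabla_form.
Proof.
(* Near [u] the component [I] is [nabla_scalar (phi e_I) / phi]. *)
split; last exact: homog_nabla_form.
move=> c ac I.
have [Ib|Ib] := eqVneq (#|I|)%:Z b; last first.
  rewrite (_ : (fun _ => _) = fun=> 0 : R); first exact: smooth_cst.
  apply/funext => u; apply/eqP; apply: contraNT Ib => h; apply/eqP; move: h.
  by rewrite form_coord_pull; apply: homog_pull; exact: homog_nabla_form.
move=> r; apply: ndifferentiable_local => u cu.
have cp := cdom_cparam ac cu.
(* A single bump function in the fixed chart [c] serves all points near [u], in place of
   [chart_bump], which changes with the point. *)
have [K [phi bphi]] := bump_exists ac cp.
have kE : kvector_field b (fscale phi (chart_lift c (ebase I))).
  by rewrite -Ib; exact: bump_lift bphi.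
have sphi := bump_smooth bphi ac.
have sE := smooth_nabla_scalar kE ac.
set D := cimg c `&` [set v | phi (cparam c v) != 0].
have oD : open D.
  have oc := cimg_open (atlas_chart ac).
  rewrite openE => v [cv pv]; apply: filterI.
    exact: open_nbhs_nbhs (conj oc cv).
  have cphi := smooth_continuous sphi cv.
  exact: (cvgr_neq0 _ cphi pv).
exists D; first by split=> //; rewrite /= (bump_at bphi) oner_eq0.
have sub : D `<=` cimg c by move=> v [].
have := ndifferentiableM oD (ndifferentiable_sub sub (sE r))
  (ndifferentiableV oD (f := phi \o cparam c) (fun v Dv => Dv.2)
    (ndifferentiable_sub sub (sphi r))).
apply: ndifferentiable_eq oD _ => v [cv pv].
have cq := cdom_cparam ac cv.
rewrite /= -(feval_nabla_form _ kE) /feval pairingZr mulrAC mulfV // mul1r.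
rewrite -[v in RHS](ccoordK_img ac cv) (form_coord_ccoord _ ac cq).
by rewrite [RHS]ffunE.
Qed.

(** Evaluation at [p] on the cut-off frame field of index [I] reads off the component [I]; the
    components of other degrees vanish for both forms. *)
Lemma nabla_form_unique eta :
  diff_form b eta -> (forall Y, kvector_field b Y ->
    of_fun (feval eta Y) = nabla_form_value nabla k l X w Y) -> nabla_form = eta.
Proof.
move=> [_ heta] eE; apply/funext => p; apply/ffunP => I.
have [Ib|Ib] := eqVneq (#|I|)%:Z b; last first.
  have Z (x : ext R n) : homog b x -> x I = 0.
    by move=> hx; apply/eqP; apply: contraNT Ib => /hx ->.
  by rewrite !Z //; exact: homog_nabla_form.
have [K bphi] := chart_bumpP p.
have kE := bump_lift I (chart_at_atlas p) bphi; rewrite Ib in kE.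
have := eE _ kE; rewrite (nabla_form_valueE kE) => /(congr1 (fun Z => Z p finset.set0)).
rewrite !scaleE ebaseE eqxx !mulr1 => E.
have := feval_nabla_form p kE; rewrite -E /feval.
by rewrite !(bump_lift_at _ bphi) !pairing_ebase.
Qed.

End NablaForm.

Unset Implicit Arguments.

Theorem theorem4p5 (R : realType) (n : nat) (M : manifold R n)
    (br nabla : ext_field M -> ext_field M -> ext_field M)
    (br_schouten : is_schouten br)
    (nabla_connection : higher_connection br nabla)
    (k l : int) (w X : ext_field M)
    (w_form : diff_form l w) (X_kvector : kvector_field k X) (k_gt0 : 0 < k) :
  exists! eta : ext_field M,
    diff_form (l - k + 1) eta /\ is_nabla_form nabla k l X w eta.
Proof.
have [b0|b0] := ltP (l - k + 1) 0.
  (* In negative degree the convention fixes the form to be 0, so uniqueness is immediate and only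
     its smoothness and degree remain. *)
  exists (fun=> 0); rewrite /is_nabla_form b0; split; last by move=> eta [].
  split=> //; split=> [c ac I|p]; last exact: homog0.
  rewrite (_ : (fun _ => _) = fun=> 0 : R); first exact: smooth_cst.
  by apply/funext => u; rewrite form_coord_pull pull0 ffunE.
have b0' : (l - k + 1 < 0) = false by rewrite ltNge b0.
exists (nabla_form nabla k l w X); rewrite /is_nabla_form b0'; split.
  split.
    exact: (nabla_form_diff_form br_schouten nabla_connection w_form X_kvector k_gt0 b0).
  move=> Y kY; rewrite (nabla_form_valueE nabla w_form X_kvector k_gt0 b0 kY).
  congr of_fun; apply/funext => p.
  exact: (feval_nabla_form br_schouten nabla_connection w_form X_kvector k_gt0 b0 p kY).
move=> eta [deta eE].
exact: (nabla_form_unique br_schouten nabla_connection w_form X_kvector k_gt0 b0 deta eE).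
Qed.
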